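(* Let $k\ge1$ be an integer, $c\in\mathbb{C}$ a constant and $\alpha\in\mathbb{R}$ with $|\alpha|\ge1$. There is a bounded linear operator $T_k:L^2(\mathbb{C},e^{-|z|^2})\to L^2(\mathbb{C},e^{-|z|^2})$ such that $$(\alpha\,\partial^k\bar\partial^k+c)\,T_k=I,$$ with operator norm satisfying $\|T_k\|^2\le\dfrac{1}{(k!)^2}$.
   Context: $\partial=\partial/\partial z$, $\bar\partial=\partial/\partial\bar z$, $\partial^k,\bar\partial^k$ are their $k$-th iterates, and $d\sigma$ is Lebesgue measure on $\mathbb{C}$. $L^2(\mathbb{C},e^{-|z|^2})$ is the Hilbert space of $f\in L^2_{loc}(\mathbb{C})$ with $\|f\|^2=\int_{\mathbb{C}}|f|^2e^{-|z|^2}d\sigma<\infty$. A function $u\in L^2_{loc}(\mathbb{C})$ is a weak solution of $\alpha\partial^k\bar\partial^ku+cu=g$ if $\int_{\mathbb{C}}u\,\big(\alpha\,\partial^k\bar\partial^k\phi+c\,\phi\big)d\sigma=\int_{\mathbb{C}}g\phi\,d\sigma$ for all smooth compactly supported $\phi:\mathbb{C}\to\mathbb{C}$. The identity $(\alpha\partial^k\bar\partial^k+c)T_k=I$ means that for every $f\in L^2(\mathbb{C},e^{-|z|^2})$, $u=T_kf$ is a weak solution of $\alpha\partial^k\bar\partial^ku+cu=f$. *)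

(* Defs.v *)
From HB Require Import structures.
From mathcomp Require Import all_boot all_order all_algebra.
From mathcomp Require Import all_classical all_reals all_analysis.
From mathcomp Require Import measurable_realfun.
From mathcomp Require Import complex ring_quotient.
From mathcomp Require Import ring lra.
Set Implicit Arguments.
Unset Strict Implicit.
Unset Printing Implicit Defensive.
Import Order.TTheory GRing.Theory Num.Theory numFieldNormedType.Exports.
Import ComplexField.Normc.
Local Open Scope classical_set_scope.
Local Open Scope ring_scope.
Local Open Scope complex_scope.

(* The complex plane is [R * R], the point [(x, y)] standing for z = x + iy;
   functions on it take values in [R[i]].  [plane R] is the same type with the
   Borel sigma-algebra on which [lebesgue_measure] is defined; a Lebesgue
   measurable function is a.e. equal to a Borel one, so working with Borel
   functions gives the usual spaces of classes modulo a.e. equality. *)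
Notation plane R := (measurableTypeR R * measurableTypeR R)%type.

Notation Re := complex.Re.
Notation Im := complex.Im.

Section Plane.
Context {R : realType}.
Implicit Types (f g u phi : R * R -> R[i]) (h : R * R -> R) (K : set (R * R)).

Definition area : {measure set (plane R) -> \bar R} :=
  (@lebesgue_measure R \x @lebesgue_measure R)%E.

Definition measurable_cfun f :=
  measurable_fun [set: plane R] (fun z => Re (f z)) /\
  measurable_fun [set: plane R] (fun z => Im (f z)).

Definition cintegral f : R[i] :=
  (\int[area]_z Re (f z)) +i* (\int[area]_z Im (f z)).

Definition L2loc f := measurable_cfun f /\
  forall K, compact K -> (\int[area]_(z in K) (normc (f z) ^+ 2)%:E < +oo)%E.

Definition weight (z : R * R) : R := expR (- (z.1 ^+ 2 + z.2 ^+ 2)).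

Definition sqnorm f : \bar R :=
  (\int[area]_z (normc (f z) ^+ 2 * weight z)%:E)%E.

Definition inL2 f := L2loc f /\ (sqnorm f < +oo)%E.

Definition ex : R * R := (1, 0).
Definition ey : R * R := (0, 1).

Fixpoint Ck (n : nat) h : Prop :=
  continuous h /\
  if n is n'.+1 then
    [/\ forall z, derivable h z ex, forall z, derivable h z ey,
        Ck n' (fun z => 'D_ex h z) & Ck n' (fun z => 'D_ey h z)]
  else True.

Definition smooth phi := forall n,
  Ck n (fun z => Re (phi z)) /\ Ck n (fun z => Im (phi z)).

Definition test_function phi :=
  smooth phi /\ compact (closure [set z | phi z != 0]).

Definition pderive (v : R * R) phi : R * R -> R[i] := fun z =>
  'D_v (fun w => Re (phi w)) z +i* 'D_v (fun w => Im (phi w)) z.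

Definition d_z phi : R * R -> R[i] := fun z =>
  2^-1 * (pderive ex phi z - 'i%C * pderive ey phi z).
Definition d_zbar phi : R * R -> R[i] := fun z =>
  2^-1 * (pderive ex phi z + 'i%C * pderive ey phi z).

Definition weak_solution (k : nat) (alpha : R) (c : R[i]) u g :=
  L2loc u /\
  forall phi, test_function phi ->
    cintegral (fun z => u z *
      (alpha%:C * iter k d_z (iter k d_zbar phi) z + c * phi z)) =
    cintegral (fun z => g z * phi z).

End Plane.

Arguments area R : simpl never.

#[global] Instance ae_area_filter (R : realType) :
  Filter (nbhs (almost_everywhere (@area R))).
Proof. exact: ae_filter_ringOfSetsType. Qed.

Section Closure.
Context {R : realType}.
Implicit Types (f g u : R * R -> R[i]) (h w : R * R -> R) (K D : set (R * R)).

Let normc2E (x : R[i]) : normc x ^+ 2 = Re x ^+ 2 + Im x ^+ 2.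
Proof. by case: x => a b /=; rewrite sqr_sqrtr// addr_ge0// sqr_ge0. Qed.

Let normc2_lin (a x y : R[i]) : normc (a * x + y) ^+ 2 <=
  2 * normc a ^+ 2 * normc x ^+ 2 + 2 * normc y ^+ 2.
Proof.
rewrite !normc2E; case: a x y => [a1 a2] [x1 x2] [y1 y2] /=.
rewrite -subr_ge0; set t := (X in 0 <= X).
suff -> : t = (a1 * x1 - a2 * x2 - y1) ^+ 2 + (a1 * x2 + a2 * x1 - y2) ^+ 2.
  by rewrite addr_ge0// sqr_ge0.
rewrite /t; ring.
Qed.

Let open_plane_measurable K : open K -> measurable (K : set (plane R)).
Proof.
move=> oK.
pose box (q : rat * rat * rat) : set (R * R) :=
  ball (ratr q.1.1 : R) (ratr q.2) `*` ball (ratr q.1.2 : R) (ratr q.2).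
pose D : set (rat * rat * rat) := [set q | box q `<=` K].
suff -> : K = \bigcup_(q in D) box q.
  rewrite bigcup_mkcond; apply: countable_bigcupT_measurable => // q.
  case: ifP => // _; apply: measurableX; exact: measurable_ball.
apply/seteqP; split => [[x y] Kxy|z [q Dq]]; last exact: Dq.
have /nbhs_ballP[e /= e0 He] := open_nbhs_nbhs (conj oK Kxy).
have [d] := rat_in_itvoo (divr_gt0 e0 (ltr0n _ 2)).
rewrite in_itv/= => /andP[d0 de].
have [p] := rat_in_itvoo (ltr_pwDr d0 (lexx x)).
have [q] := rat_in_itvoo (ltr_pwDr d0 (lexx y)).
rewrite !in_itv/= => /andP[yq qd] /andP[xp pd].
exists (p, q, d); last first.
  split; rewrite /ball/= ltr_distl; lra.
move=> [u v] []; rewrite /ball/= => Hu Hv; apply: He.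
split; rewrite /ball/= ltr_distl.
  by move: Hu; rewrite ltr_distl; lra.
by move: Hv; rewrite ltr_distl; lra.
Qed.

Let compact_plane_measurable K : compact K -> measurable (K : set (plane R)).
Proof.
move=> cK; rewrite -[K]setCK; apply: measurableC.
apply: open_plane_measurable; rewrite openC.
by apply: compact_closed => //; exact: norm_hausdorff.
Qed.

Let measurable_normc2 f : measurable_cfun f ->
  measurable_fun [set: plane R] (fun z => normc (f z) ^+ 2).
Proof.
move=> [mr mi]; under eq_fun do rewrite normc2E.
by apply: measurable_funD; apply: measurable_funX.
Qed.

Let measurable_cfun_lin (a : R[i]) f g : measurable_cfun f ->
  measurable_cfun g -> measurable_cfun (a *: f + g).
Proof.
move=> [fr fi] [gr gi]; split.
  rewrite (_ : (fun _ => _) =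
    (fun z => (Re a * Re (f z) - Im a * Im (f z)) + Re (g z))).
    by apply: measurable_funD => //; apply: measurable_funB;
      apply: measurable_funM.
  apply/funext => z; rewrite /= -[(_ + _) z]/(a * f z + g z).
  by case: a (f z) (g z) => [? ?] [? ?] [? ?].
rewrite (_ : (fun _ => _) =
  (fun z => (Re a * Im (f z) + Im a * Re (f z)) + Im (g z))).
  by apply: measurable_funD => //; apply: measurable_funD;
    apply: measurable_funM.
apply/funext => z; rewrite /= -[(_ + _) z]/(a * f z + g z).
by case: a (f z) (g z) => [? ?] [? ?] [? ?].
Qed.

Let fin_int_lin (D : set (plane R)) w (a : R[i]) f g : measurable D ->
  measurable_fun [set: plane R] w -> (forall z, 0 <= w z) ->
  measurable_cfun f -> measurable_cfun g ->
  (\int[area]_(z in D) (normc (f z) ^+ 2 * w z)%:E < +oo)%E ->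
  (\int[area]_(z in D) (normc (g z) ^+ 2 * w z)%:E < +oo)%E ->
  (\int[area]_(z in D) (normc ((a *: f + g) z) ^+ 2 * w z)%:E < +oo)%E.
Proof.
move=> mD mw w0 mf mg If Ig.
have mF u : measurable_cfun u ->
    measurable_fun D (fun z : plane R => (normc (u z) ^+ 2 * w z)%:E).
  move=> mu; apply/measurable_EFinP; apply: (measurable_funS measurableT) => //.
  by apply: measurable_funM => //; exact: measurable_normc2.
have F0 u z : (0 <= (normc (u z) ^+ 2 * w z)%:E)%E.
  by rewrite lee_fin mulr_ge0// sqr_ge0.
have c0 : 0 <= 2 * normc a ^+ 2 by rewrite mulr_ge0// sqr_ge0.
pose G (z : plane R) := ((2 * normc a ^+ 2)%:E * (normc (f z) ^+ 2 * w z)%:E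
  + 2%:E * (normc (g z) ^+ 2 * w z)%:E)%E.
apply: (@le_lt_trans _ _ (\int[area]_(z in D) G z)%E).
  apply: ge0_le_integral => //.
  - by apply: mF; exact: measurable_cfun_lin.
  - by apply: emeasurable_funD; apply: measurable_funeM; exact: mF.
  - move=> z _; rewrite /G -!EFinM -EFinD lee_fin.
    apply: le_trans (ler_wpM2r (w0 z) (normc2_lin a (f z) (g z))) _.
    by rewrite mulrDl !mulrA.
rewrite ge0_integralD//; last first.
all: try by [apply: measurable_funeM; exact: mF | move=> z _; rewrite mule_ge0].
rewrite ge0_integralZl//; last exact: mF.
rewrite ge0_integralZl//; last exact: mF.
by rewrite lte_add_pinfty// lte_mul_pinfty.
Qed.

Let measurable_weight : measurable_fun [set: plane R] (@weight R).
Proof.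
apply: measurableT_comp => //; apply: measurableT_comp => //.
by apply: measurable_funD; apply: measurable_funX.
Qed.

Lemma inL2_submod_closed : submod_closed (mem [set f | @inL2 R f]).
Proof.
split=> [|a f g].
  have n0 : normc (0 : R[i]) ^+ 2 = 0 by rewrite normc0 expr0n.
  rewrite inE /=; split; first split.
  - by split => /=; exact: measurable_cst.
  - by move=> K _; rewrite integral0_eq// => z _; rewrite n0.
  - by rewrite /sqnorm integral0_eq// => z _; rewrite n0 mul0r.
rewrite !inE /= => -[[mf Kf] nf] [[mg Kg] ng].
split; last by apply: fin_int_lin => // z; exact: expR_ge0.
split=> [|K cK]; first exact: measurable_cfun_lin.
have E u : (\int[area]_(z in K) (normc (u z) ^+ 2)%:E =
    \int[area]_(z in K) (normc (u z) ^+ 2 * (cst 1 : R * R -> R) z)%:E)%E.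
  by apply: eq_integral => z _; rewrite mulr1.
rewrite E; apply: fin_int_lin => //; first exact: compact_plane_measurable.
  by rewrite -E; exact: Kf.
by rewrite -E; exact: Kg.
Qed.

End Closure.

Definition L2pred (R : realType) : {pred (R * R -> R[i])} :=
  mem [set f | @inL2 R f].

HB.instance Definition _ (R : realType) :=
  GRing.isSubmodClosed.Build R[i] (R * R -> R[i]) (@L2pred R)
    (@inL2_submod_closed R).

Record L2fun (R : realType) :=
  MkL2fun { L2fun_val :> R * R -> R[i] ; _ : L2fun_val \in @L2pred R }.

HB.instance Definition _ (R : realType) := [isSub for @L2fun_val R].
HB.instance Definition _ (R : realType) := [Choice of L2fun R by <:].
HB.instance Definition _ (R : realType) :=
  [SubChoice_isSubLmodule of L2fun R by <:].

Definition null_L2 (R : realType) : {pred L2fun R} :=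
  mem [set f : L2fun R | {ae @area R, forall z, f z = 0}].

Section Quotient.
Context {R : realType}.

Lemma null_L2_submod_closed : submod_closed (@null_L2 R).
Proof.
split=> [|a f g]; rewrite !inE; first exact: aeW.
move=> f0 g0.
by move: f0 g0; apply: filterS2 => z f0 g0; rewrite -[LHS]/(a * f z + g z) f0 g0 mulr0 addr0.
Qed.

HB.instance Definition _ :=
  GRing.isSubmodClosed.Build R[i] (L2fun R) (@null_L2 R)
    null_L2_submod_closed.

End Quotient.


(* L^2(C, exp(-|z|^2)), as classes modulo a.e. equality (see [L2class_eq]) *)
Definition L2 (R : realType) : Type := Quotient.quot (@null_L2 R).

Section L2Lmodule.
Context {R : realType}.
Local Open Scope quotient_scope.
Implicit Types (a b : R[i]) (f g : L2 R).

HB.instance Definition _ := GRing.Zmodule.on (L2 R).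
HB.instance Definition _ := EqQuotient.on (L2 R).

Definition L2class (f : L2fun R) : L2 R := \pi_(L2 R) f.

Lemma L2class_eq (f g : L2fun R) :
  L2class f = L2class g <-> {ae @area R, forall z, f z = g z}.
Proof.
rewrite /L2class; split=> [/eqP|fg].
  rewrite -Quotient.idealrBE inE/=; apply: filterS => z /eqP.
  by rewrite -[X in X == _]/(f z - g z) subr_eq0 => /eqP.
apply/eqP; rewrite -Quotient.idealrBE inE/=; apply: filterS fg => z fg.
by rewrite -[LHS]/(f z - g z) fg subrr.
Qed.

Definition L2scale a f : L2 R := L2class (a *: repr f).

Let L2scale_class a (f : L2fun R) : L2scale a (L2class f) = L2class (a *: f).
Proof.
apply/L2class_eq; have /L2class_eq : L2class (repr (L2class f)) = L2class f.
  exact: reprK.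
by apply: filterS => z fz; rewrite -[LHS]/(a * repr (L2class f) z) fz.
Qed.

Let L2classD (f g : L2fun R) : L2class (f + g) = L2class f + L2class g.
Proof. by rewrite /L2class !piE. Qed.

Let L2scaleA a b f : L2scale a (L2scale b f) = L2scale (a * b) f.
Proof. by rewrite L2scale_class scalerA. Qed.

Let L2scale1 : left_id 1 L2scale.
Proof. by move=> f; rewrite /L2scale scale1r; exact: reprK. Qed.

Let L2scaleDr : right_distributive L2scale +%R.
Proof.
move=> a f g; rewrite -[f]reprK -[g]reprK -!/(L2class _) -L2classD.
by rewrite !L2scale_class scalerDr L2classD.
Qed.

Let L2scaleDl f : {morph L2scale^~ f : a b / a + b}.
Proof. by move=> a b; rewrite /L2scale scalerDl L2classD. Qed.

HB.instance Definition _ := GRing.Zmodule_isLmodule.Build R[i] (L2 R)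
  L2scaleA L2scale1 L2scaleDr L2scaleDl.

(* A representative of the class; [sqnorm] and [weak_solution] do not depend on
   its choice. *)
Definition L2repr f : R * R -> R[i] := repr f.

Definition L2norm f : R := Num.sqrt (fine (sqnorm (L2repr f))).

Definition bounded_operator (T : {linear L2 R -> L2 R}) :=
  exists M : R, forall f, L2norm (T f) <= M * L2norm f.

Definition opnorm (T : {linear L2 R -> L2 R}) : R :=
  sup [set L2norm (T f) | f in [set f | L2norm f <= 1]].

End L2Lmodule.

(* Main.v *)
Require Import Defs.
From HB Require Import structures.
From mathcomp Require Import all_boot all_order all_algebra.
From mathcomp Require Import all_classical all_reals all_analysis.
From mathcomp Require Import measurable_realfun complex.
From mathcomp Require Import ring lra.
Import Order.TTheory GRing.Theory Num.Theory numFieldNormedType.Exports.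
Import ComplexField.Normc.
Local Open Scope classical_set_scope.
Local Open Scope ring_scope.
Local Open Scope complex_scope.
Set Implicit Arguments.
Unset Strict Implicit.
Unset Printing Implicit Defensive.

(* Let L = alpha d^k dbar^k + c.  A function u solves the equation weakly with
   datum f iff its pairing with L phi equals the pairing of f with phi for all
   test functions phi, so by the Riesz representation theorem it suffices to
   prove k! |phi| <= |L phi| for the norm of L^2(exp(|z|^2)) on test functions.
   For that weight d and dbar are two commuting creation operators: their
   adjoints are -(dbar + z) and -(d + conj z), with [d*, d] = [dbar*, dbar] = 1
   and [d*, dbar] = 0.  As L and L* have the same cross terms,
   |L phi|^2 - |L* phi|^2 = alpha^2 (|d^k dbar^k phi|^2 - |(d^k dbar^k)* phi|^2),
   and the ladder relations bound the right-hand side below by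
   alpha^2 (k!)^2 |phi|^2. *)

Local Notation Re := complex.Re.
Local Notation Im := complex.Im.

(** * Hermitian forms and ladder operators *)

(** The weight exp(|z|^2) is forced by duality: the integral of u psi is the inner product in
    L^2(exp(-|z|^2)) of u with conj(psi) exp(|z|^2), and the norm of that vector is the norm of psi
    for the inverse weight. The embedding is conjugate-linear, which is why the abstract Riesz lemma
    takes conjugate-linear maps. The estimate does not depend on c because c enters |L phi|^2 and
    |L* phi|^2 in the same way. Each of the two ladders contributes a factor k! to the squared norm,
    hence the bound 1/k! for the solution. Solutions need not be unique, so a bound for each datum
    does not yet give an operator. The solution chosen is orthogonal to everything that annihilates
    the dual vectors of all L phi; this makes it unique up to null functions, and therefore linear
    in f. The forms are only semidefinite on functions, as opposed to classes, and test functions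
    are not complete, so the solution is built as the limit of a minimising sequence. Only real
    parts of forms are used; imaginary parts are recovered by replacing psi with -i psi. *)

Section RealHermitian.
Context {R : realType} {V : lmodType R[i]}.
Implicit Types (x y z : V) (a : R[i]) (t : R).

(* The real part of a positive semidefinite Hermitian form; it determines the
   form, since the imaginary part of (x, y) is the real part of (x, i y). *)
Record re_hermitian (b : V -> V -> R) : Prop := ReHermitian {
  rhC : forall x y, b x y = b y x;
  rhDl : forall x y z, b (x + y) z = b x z + b y z;
  rhZl : forall t x y, b (t%:C *: x) y = t * b x y;
  rh_conj : forall a x y, b (a *: x) y = b x (a^*%C *: y);
  rh_ge0 : forall x, 0 <= b x x }.

Definition rh_norm (b : V -> V -> R) x := Num.sqrt (b x x).

Context {b : V -> V -> R} (hb : re_hermitian b).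

Lemma rhDr x y z : b z (x + y) = b z x + b z y.
Proof. by rewrite rhC// rhDl// !(rhC hb _ z). Qed.

Lemma rhZr t x y : b x (t%:C *: y) = t * b x y.
Proof. by rewrite rhC// rhZl// rhC. Qed.

Lemma rh0l x : b 0 x = 0.
Proof. by rewrite -(scale0r 0) (rhZl hb 0) mul0r. Qed.

Lemma rh0r x : b x 0 = 0.
Proof. by rewrite rhC// rh0l. Qed.

Lemma rhNl x y : b (- x) y = - b x y.
Proof. by apply/eqP; rewrite -subr_eq0 opprK -rhDl// addNr rh0l. Qed.

Lemma rhNr x y : b x (- y) = - b x y.
Proof. by rewrite rhC// rhNl rhC. Qed.

Lemma rhMnr x y n : b x (y *+ n) = b x y *+ n.
Proof. by elim: n => [|n IH]; rewrite ?mulr0n ?rh0r// !mulrS rhDr IH. Qed.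

Lemma rh_norm_ge0 x : 0 <= rh_norm b x.
Proof. exact: sqrtr_ge0. Qed.

Lemma rh_norm2 x : rh_norm b x ^+ 2 = b x x.
Proof. by rewrite sqr_sqrtr// rh_ge0. Qed.

Lemma rh_sqD t x y : b (x + t%:C *: y) (x + t%:C *: y) =
  b x x + 2 * t * b x y + t ^+ 2 * b y y.
Proof.
rewrite rhDl// !rhDr !(rhZl hb) !rhZr (rhC hb y x); ring.
Qed.

(** Positivity of the form at x + t y. Since [b] is only semidefinite, a null vector y is treated
    apart: if [b x y] were nonzero, the chosen t would give the value -1. Otherwise t is the
    minimiser of the quadratic polynomial. *)
Lemma rh_CS2 x y : b x y ^+ 2 <= b x x * b y y.
Proof.
have [yy0|yy0] := eqVneq (b y y) 0.
  rewrite yy0 mulr0 exprn_even_le0//=; apply: contraT => xy0.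
  have := rh_ge0 hb (x + (- (b x x + 1) / (2 * b x y))%:C *: y).
  rewrite rh_sqD yy0 mulr0 addr0 [X in _ + X](_ : _ = - (b x x + 1)).
    lra.
  by field.
have y0 : 0 < b y y by rewrite lt_neqAle eq_sym yy0 rh_ge0.
have := rh_ge0 hb (x + (- b x y / b y y)%:C *: y); rewrite rh_sqD.
rewrite (_ : _ + _ = (b x x * b y y - b x y ^+ 2) / b y y); last by field.
by rewrite pmulr_lge0 ?invr_gt0// subr_ge0.
Qed.

Lemma rh_CS x y : b x y <= rh_norm b x * rh_norm b y.
Proof.
rewrite -sqrtrM ?rh_ge0//; apply: le_trans (ler_norm _) _.
by rewrite -sqrtr_sqr ler_wsqrtr// rh_CS2.
Qed.

End RealHermitian.

(** * Norm inequalities that follow from the commutation relation A' A = A A' + 1 *)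

Section Ladder.
Context {R : realType} {V : lmodType R[i]} {b : V -> V -> R}.
Hypothesis hb : re_hermitian b.
Implicit Types (x y : V).

Section One.
Variables (A : {linear V -> V}) (A' : V -> V).
Hypothesis adjA : forall x y, b (A x) y = b x (A' y).
Hypothesis commA : forall x, A' (A x) = A (A' x) + x.

Lemma adj_iter k x y : b (iter k A x) y = b x (iter k A' y).
Proof. by elim: k x y => //= k IH x y; rewrite adjA IH -iterSr. Qed.

Lemma lower_iter k y :
  A' (iter k.+1 A y) = iter k.+1 A (A' y) + iter k A y *+ k.+1.
Proof.
elim: k => [|k IH]; first by rewrite /= commA mulr1n.
rewrite [iter k.+2 A y]iterS commA IH linearD linearMn -!iterS -addrA.
by rewrite -mulrSr.
Qed.

(** Moving one [A] across the form and commuting it through with [lower_iter] gives |A^(k+1) A' y|^2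
    plus k+1 times the cross term of the previous rank, which is nonnegative by induction. *)
Lemma ladder_cross_ge k y :
  b (iter k A (A' y)) (iter k A (A' y)) <=
  b (iter k.+1 A (A' y)) (iter k A y).
Proof.
elim: k => [|k IH]; first by rewrite /= adjA.
rewrite [iter k.+2 _ _]iterS adjA lower_iter rhDr// rhMnr// lerDl.
by rewrite mulrn_wge0// (le_trans _ IH)// rh_ge0.
Qed.

(** The square |A^(k+1) y|^2 equals the cross term of [ladder_cross_ge] plus (k+1) |A^k y|^2.
    Iterating the second summand produces k!; iterating the first compares powers of [A'] with
    powers of [A]. *)
Lemma ladder_step k y :
  b (iter k A (A' y)) (iter k A (A' y)) + b (iter k A y) (iter k A y) *+ k.+1
  <= b (iter k.+1 A y) (iter k.+1 A y).
Proof.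
rewrite -[leRHS]/(b (A (iter k A y)) (iter k.+1 A y)) adjA lower_iter.
rewrite rhDr// rhMnr// lerD2r (rhC hb (iter k A y)).
exact: ladder_cross_ge.
Qed.

Lemma ladder_le k y :
  b (iter k A' y) (iter k A' y) <= b (iter k A y) (iter k A y).
Proof.
elim: k y => // k IH y; apply: le_trans (ladder_step k y).
by rewrite iterSr (le_trans (IH _))// lerDl mulrn_wge0// rh_ge0.
Qed.

Lemma ladder_fact k y : b y y *+ k`! <= b (iter k A y) (iter k A y).
Proof.
elim: k => [|k IH]; first by rewrite fact0 mulr1n.
apply: le_trans (ladder_step k y).
rewrite factS mulnC mulrnA ler_wpDl ?rh_ge0//.
by rewrite ler_wMn2r.
Qed.

(** Both gains are kept at once: in [ladder_step] one summand is bounded by [ladder_le] and the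
    other by [ladder_fact]. At k = 0 the left side would be 2 |y|^2. *)
Lemma ladder_bound k y : (0 < k)%N ->
  b (iter k A' y) (iter k A' y) + b y y *+ k`! <= b (iter k A y) (iter k A y).
Proof.
case: k => // k _; apply: le_trans (ladder_step k y); apply: lerD.
  by rewrite iterSr ladder_le.
rewrite factS mulnC mulrnA.
by rewrite ler_wMn2r// ladder_fact.
Qed.

End One.

Variables (A B : {linear V -> V}) (A' B' : V -> V).
Hypothesis adjA : forall x y, b (A x) y = b x (A' y).
Hypothesis adjB : forall x y, b (B x) y = b x (B' y).
Hypothesis commA : forall x, A' (A x) = A (A' x) + x.
Hypothesis commB : forall x, B' (B x) = B (B' x) + x.
Hypothesis commAB' : forall x, A' (B x) = B (A' x).

Let iterC (f g : V -> V) n m x : (forall x, f (g x) = g (f x)) ->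
  iter n f (iter m g x) = iter m g (iter n f x).
Proof.
move=> fg; have fgm y : f (iter m g y) = iter m g (f y).
  by elim: m => //= m <-.
by elim: n => //= n ->.
Qed.

(** [ladder_bound] for [A] at B^k x leaves |A'^k B^k x|^2 + k! |B^k x|^2. As A'^k commutes with B^k,
    [ladder_bound] for [B] applies to both terms, at A'^k x and at x; the two middle terms k! |A'^k
    x|^2 and k! |B'^k x|^2 are dropped. *)
Let norm_lb k x : (0 < k)%N ->
  b (iter k B' (iter k A' x)) (iter k B' (iter k A' x)) + b x x *+ (k`! * k`!)
  <= b (iter k A (iter k B x)) (iter k A (iter k B x)).
Proof.
move=> k0; apply: le_trans (ladder_bound adjA commA _ k0).
rewrite (iterC _ _ _ commAB'); have lbB := ladder_bound adjB commB _ k0.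
apply: le_trans (lerD (lbB (iter k A' x)) (ler_wMn2r k`! (lbB x))).
rewrite -addrA lerD2l mulrnA mulrnDl -[leLHS]add0r lerD//.
  by rewrite mulrn_wge0// rh_ge0.
by rewrite lerDr mulrn_wge0// rh_ge0.
Qed.

(* For L = a A^k B^k + c the cross terms of |L x|^2 and of its adjoint agree,
   so |L x|^2 - |L' x|^2 is a^2 (|A^k B^k x|^2 - |B'^k A'^k x|^2). *)
Lemma ladder_pair_bound k (a : R) (c : R[i]) x : (0 < k)%N -> 1 <= `|a| ->
  k`!%:R ^+ 2 * b x x <=
  b (a%:C *: iter k A (iter k B x) + c *: x)
    (a%:C *: iter k A (iter k B x) + c *: x).
Proof.
move=> k0 a1; set M := iter k A (iter k B x).
set M' := iter k B' (iter k A' x).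
have a2 : 1 <= a ^+ 2 by rewrite -real_normK ?num_real// expr_ge1.
have E (u v : V) : b (a%:C *: u + v) (a%:C *: u + v) =
    a ^+ 2 * b u u + 2 * a * b u v + b v v.
  by rewrite addrC rh_sqD// (rhC hb v u); ring.
have iterZ (f : {linear V -> V}) n (d : R[i]) y :
    iter n f (d *: y) = d *: iter n f y.
  by elim: n => //= n ->; rewrite linearZ.
(* The real part is symmetric, so the scalar can be moved onto [M] as its conjugate, pulled through
   the linear powers, and the powers then moved to the other side as adjoints. *)
have cross : b M (c *: x) = b M' (c^*%C *: x).
  rewrite (rhC hb M) (rh_conj hb) (rhC hb x).
  by rewrite -!iterZ !(adj_iter adjA, adj_iter adjB) (rhC hb).
have cc : b (c *: x) (c *: x) = b (c^*%C *: x) (c^*%C *: x).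
  by rewrite !(rh_conj hb) !scalerA conjcK mulrC.
have pos := rh_ge0 hb (a%:C *: M' + c^*%C *: x).
have := norm_lb x k0; rewrite -/M -/M' -[_ *+ (_ * _)]mulr_natl natrM -expr2.
rewrite E cross cc; move: pos; rewrite E.
have F0 : 0 <= (k`!%:R : R) ^+ 2 * b x x by rewrite mulr_ge0 ?rh_ge0.
move: F0; set F := _ * b x x; nra.
Qed.

End Ladder.

(** * Riesz representation *)

Lemma cvg0_le0 {R : realType} (x c : R) (s : R^nat) :
  s @ \oo --> 0 -> (forall n, x <= c * s n) -> x <= 0.
Proof.
move=> s0 xs; rewrite -(mulr0 c).
have cs : (fun n => c * s n) @ \oo --> c * 0 by apply: cvgM s0; exact: cvg_cst.
by apply: (cvgr_to_ge cs); exact: nearW.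
Qed.

Section Riesz.
Context {R : realType} {H V : lmodType R[i]} {b : H -> H -> R}.
Hypothesis hb : re_hermitian b.
Hypothesis completeH : forall w : nat -> H,
  (forall n, b (w n.+1 - w n) (w n.+1 - w n) <= 4^-1 ^+ n) ->
  exists u, (fun n => b (u - w n) (u - w n)) @ \oo --> 0.
Variables (J G : V -> H) (C : R).
Hypothesis J_conj : forall (a : R[i]) x y, J (a *: x + y) = a^*%C *: J x + J y.
Hypothesis G_conj : forall (a : R[i]) x y, G (a *: x + y) = a^*%C *: G x + G y.
Hypothesis C_ge0 : 0 <= C.
Hypothesis JG : forall x, rh_norm b (J x) <= C * rh_norm b (G x).

Let conjr (t : R) : (t%:C)^*%C = t%:C. Proof. by rewrite /= oppr0. Qed.

Lemma rh_norm_le_add x y : rh_norm b y <= rh_norm b x + rh_norm b (x - y).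
Proof.
rewrite -(ler_pXn2r (ltn0Sn 1)) ?nnegrE ?addr_ge0 ?rh_norm_ge0//.
have -> : rh_norm b y ^+ 2 = rh_norm b x ^+ 2 + 2 * b x (y - x) +
    rh_norm b (x - y) ^+ 2.
  rewrite !rh_norm2// !(rhDl hb, rhDr hb, rhNl hb, rhNr hb).
  rewrite (rhC hb y x); ring.
have := rh_CS hb x (y - x).
have -> : rh_norm b (y - x) = rh_norm b (x - y).
  by rewrite -[y - x]opprB /rh_norm (rhNl hb) (rhNr hb) opprK.
lra.
Qed.

(* The functional [J x |-> b f (J x)], bounded in terms of [G x], is
   represented by the limit of [G (x n)] for a sequence [x n] minimising
   [b (G x) (G x) - 2 b f (J x)]. *)
Lemma riesz_solution f : exists u,
  [/\ forall x, b u (G x) = b f (J x),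
      forall v, (forall x, b (G x) v = 0) -> b u v = 0 &
      rh_norm b u <= C * rh_norm b f].
Proof.
pose F x := b (G x) (G x) - 2 * b f (J x).
have fJ x : b f (J x) <= C * rh_norm b f * rh_norm b (G x).
  apply: le_trans (rh_CS hb _ _) _; rewrite -mulrA mulrCA.
  by rewrite ler_wpM2l ?rh_norm_ge0.
(* Completing the square in |G x|, the linear term being controlled by [fJ]. *)
have Flb x : - (C * rh_norm b f) ^+ 2 <= F x.
  have := sqr_ge0 (rh_norm b (G x) - C * rh_norm b f).
  rewrite /F -rh_norm2//; have := fJ x; nra.
have hasF : has_inf (range F).
  split; first by exists (F 0), 0.
  by exists (- (C * rh_norm b f) ^+ 2) => _ [x _ <-].
set m := inf (range F).
have mF x : m <= F x by apply: ge_inf; [exact: hasF.2 | exists x].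
(* The tolerance is tuned to [completeH]: the squared distance of consecutive terms will be at most
   2 (e n + e (n+1)), which is below 4^-n. *)
pose e n : R := 4^-1 ^+ n.+1.
have e_gt0 n : 0 < e n by rewrite exprn_gt0.
have /choice[x xP] n : exists x, F x < m + e n.
  by have [_ [x _ <-]] := inf_adherent (e_gt0 n) hasF; exists x.
have e0 : e @ \oo --> 0.
  rewrite /e; have /(@cvg_geometric R (4^-1)) : `|4^-1 : R| < 1.
    by rewrite ger0_norm// invf_lt1//; lra.
  rewrite (_ : geometric _ _ = (fun n => 4^-1 ^+ n.+1))//.
  by apply/funext => n; rewrite /= exprS.
have GZ (t : R) y : G (t%:C *: y) = t%:C *: G y.
  have := G_conj (t%:C) y 0; rewrite addr0 conjr => ->.
  by have := G_conj 1 0 0; rewrite scaler0 addr0 conjc1 scale1r => /eqP;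
    rewrite -subr_eq0 opprD addrA subrr sub0r oppr_eq0 => /eqP ->; rewrite addr0.
have JZ (t : R) y : J (t%:C *: y) = t%:C *: J y.
  have := J_conj (t%:C) y 0; rewrite addr0 conjr => ->.
  by have := J_conj 1 0 0; rewrite scaler0 addr0 conjc1 scale1r => /eqP;
    rewrite -subr_eq0 opprD addrA subrr sub0r oppr_eq0 => /eqP ->; rewrite addr0.
have GD (t : R) y z : G (y + t%:C *: z) = G y + t%:C *: G z.
  by rewrite -{1}[y]scale1r G_conj conjc1 scale1r GZ.
have JD (t : R) y z : J (y + t%:C *: z) = J y + t%:C *: J z.
  by rewrite -{1}[y]scale1r J_conj conjc1 scale1r JZ.
have FD (t : R) y z : F (y + t%:C *: z) =
    F y + 2 * t * (b (G y) (G z) - b f (J z)) + t ^+ 2 * b (G z) (G z).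
  rewrite /F GD JD rh_sqD// (rhDr hb) (rhZr hb); ring.
have FZ (t : R) y : F (t%:C *: y) = t ^+ 2 * b (G y) (G y) - 2 * t * b f (J y).
  rewrite /F GZ JZ (rhZl hb) !(rhZr hb); ring.
(* Parallelogram identity: the linear part of [F] cancels in 2 F x + 2 F y - 4 F ((x + y) / 2) = |G
   x - G y|^2, and the value at the midpoint is at least [m]. *)
have /completeH[u uP] n :
    b (G (x n.+1) - G (x n)) (G (x n.+1) - G (x n)) <= 4^-1 ^+ n.
  have := mF ((2^-1)%:C *: (x n.+1 + 1%:C *: x n)).
  rewrite FZ GD JD rh_sqD// !(rhDl hb, rhDr hb, rhNl hb, rhNr hb, rhZr hb).
  rewrite (rhC hb (G (x n))); have := xP n; have := xP n.+1.
  rewrite /F /e !exprS; have : 0 < (4^-1 : R) ^+ n by rewrite exprn_gt0.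
  set g1 := b (G (x n.+1)) (G (x n.+1)); set g0 := b (G (x n)) (G (x n)).
  set q := _ ^+ n; lra.
set d := fun n => b (u - G (x n)) (u - G (x n)).
have d_ge0 n : 0 <= d n by exact: rh_ge0.
(* Such a v pairs with u as it does with u - G (x n), which tends to 0. *)
have uperp v : (forall x, b (G x) v = 0) -> b u v = 0.
  move=> Gv; apply/eqP; rewrite -sqrf_eq0 eq_le sqr_ge0 andbT; apply: (cvg0_le0 (c := b v v)) uP _ => n.
  have -> : b u v = b (u - G (x n)) v by rewrite (rhDl hb) (rhNl hb) Gv subr0.
  by rewrite mulrC rh_CS2.
have uG y : b u (G y) = b f (J y).
  apply/eqP; rewrite -subr_eq0 -sqrf_eq0 eq_le sqr_ge0 andbT.
  set q := b (G y) (G y); have q0 : 0 <= q by exact: rh_ge0.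
  apply: (cvg0_le0 (c := 2 * (q + 1)) (s := e \+ d)) => [|n].
    by rewrite -[0]addr0; apply: cvgD.
  (* Half the derivative of [F] at [x n] in direction y. It is small because [x n] almost minimises
     [F]: compare with the step -en / (q + 1), where q + 1 replaces q to avoid dividing by zero when
     G y is null. *)
  set en := b (G (x n)) (G y) - b f (J y).
  have en2 : en ^+ 2 <= e n * (q + 1).
    have := mF (x n + (- en / (q + 1))%:C *: y); rewrite FD -/en -/q.
    set s := en / (q + 1); have q1 : 0 < q + 1 by lra.
    rewrite mulNr -/s; have -> : en = s * (q + 1) by rewrite /s divfK// gt_eqF.
    have := xP n; have := e_gt0 n; nra.
  have dn2 : b (u - G (x n)) (G y) ^+ 2 <= d n * q by exact: rh_CS2.
  have -> : b u (G y) - b f (J y) = en + b (u - G (x n)) (G y).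
    by rewrite /en (rhDl hb) (rhNl hb); ring.
  move: (d_ge0 n) en2 dn2; rewrite /=; set D := b _ _.
  have := sqr_ge0 (en - D); nra.
exists u; split => //.
set U := rh_norm b u; set Q := C * rh_norm b f.
have U0 : 0 <= U by exact: rh_norm_ge0.
have Q0 : 0 <= Q by rewrite mulr_ge0 ?rh_norm_ge0.
(* The bound for the functional is only known on the range of [G], so u is replaced by G (x n) in
   one slot; the error is at most (U + Q) |u - G (x n)|. *)
have : U ^+ 2 - Q * U <= 0.
  apply: (cvg0_le0 (c := U + Q) (s := fun n => Num.sqrt (d n))) => [|n].
    rewrite -[X in _ --> X]sqrtr0; apply: continuous_cvg uP.
    exact: sqrt_continuous.
  rewrite -/(rh_norm b (u - G (x n))); set D := rh_norm _ _.
  have -> : U ^+ 2 = b u (u - G (x n)) + b u (G (x n)).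
    by rewrite -(rhDr hb) subrK rh_norm2.
  have h1 : b u (u - G (x n)) <= U * D by exact: rh_CS.
  have h2 : b u (G (x n)) <= Q * rh_norm b (G (x n)) by rewrite uG.
  have := rh_norm_le_add u (G (x n)); rewrite -/U -/D.
  move: h1 h2; nra.
nra.
Qed.

End Riesz.

(** * Completeness of L2 *)

(** Cauchy-Schwarz with weights 2^-j, whose tail from n sums to 2 * 2^-n. In the induction it takes
    the form (X + Y)^2 <= 2 X^2 + 2 Y^2, the factor 2 being absorbed by passing from 2^-(n+1) to
    2^-n. *)
Lemma fast_cauchy_sqr_dist {R : realType} (u : nat -> R) n p :
  (u (n + p)%N - u n) ^+ 2 <=
  2 * 2^-1 ^+ n * \sum_(n <= j < n + p) 2 ^+ j * (u j.+1 - u j) ^+ 2.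
Proof.
elim: p n => [|p IH] n.
  by rewrite addn0 subrr expr0n big_geq// mulr0.
rewrite big_ltn; last by rewrite addnS ltnS leq_addr.
have := IH n.+1; rewrite addSnnS; set T := \sum_(_ <= _ < _) _ => IHT.
rewrite mulrDr !mulrA -[2 * _ * 2 ^+ n]mulrA -exprMn mulVf ?expr1n// mulr1.
have -> : u (n + p.+1)%N - u n = (u (n + p.+1)%N - u n.+1) + (u n.+1 - u n).
  by ring.
move: IHT; set X := u _ - _; set Y := u _ - _.
have := sqr_ge0 (X - Y); rewrite (exprS 2^-1 n); set q := 2^-1 ^+ n; nra.
Qed.

Section L2complete.
Context {d} {T : measurableType d} {R : realType}.
Variable mu : {measure set T -> \bar R}.
Variable g : nat -> T -> R.
Hypothesis mg : forall n, measurable_fun [set: T] (g n).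
Hypothesis g_fast : forall n,
  (\int[mu]_x ((g n.+1 x - g n x) ^+ 2)%:E <= (4^-1 ^+ n)%:E)%E.

(** The weights 2^j spend half of the decay 4^-j: the integral of [S] is still finite, at most 2,
    and finiteness of [S x] makes the sequence Cauchy at x with an explicit rate. *)
Let S x := (\sum_(j <oo) (2 ^+ j * (g j.+1 x - g j x) ^+ 2)%:E)%E.

Let term_ge0 j x : (0 <= (2 ^+ j * (g j.+1 x - g j x) ^+ 2)%:E)%E.
Proof. by rewrite lee_fin mulr_ge0// sqr_ge0. Qed.

Let measurable_diff2 (h : T -> R) n : measurable_fun [set: T] h ->
  measurable_fun [set: T] (fun x => ((h x - g n x) ^+ 2)%:E).
Proof.
by move=> mh; apply/measurable_EFinP; apply: measurable_funX;
  exact: measurable_funB.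
Qed.

Let measurable_term j :
  measurable_fun [set: T] (fun x => (2 ^+ j * (g j.+1 x - g j x) ^+ 2)%:E).
Proof.
by under eq_fun do rewrite EFinM; apply: measurable_funeM;
  exact: measurable_diff2.
Qed.

Let measurable_S : measurable_fun [set: T] S.
Proof. exact: ge0_emeasurable_sum. Qed.

Let int_S : (\int[mu]_x S x <= 2%:E)%E.
Proof.
rewrite integral_nneseries//.
apply: le_trans (epsilon_trick0 xpredT (ler0n R 2)).
apply: lee_nneseries => [j _ _|j _]; first exact: integral_ge0.
under eq_integral do rewrite EFinM.
rewrite ge0_integralZl//; last 2 first.
- exact: measurable_diff2.
- by move=> x _; rewrite lee_fin sqr_ge0.
apply: le_trans (lee_wpmul2l _ (g_fast j)) _; first by rewrite lee_fin exprn_ge0.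
rewrite -EFinM lee_fin -exprMn natrX exprS invfM mulrA divff// mul1r -exprVn.
by rewrite (_ : 2 * 4^-1 = 2^-1)//; field.
Qed.

Let S_bound n x s : S x = s%:E -> forall m, (n <= m)%N ->
  (g m x - g n x) ^+ 2 <= 2 * 2^-1 ^+ n * s.
Proof.
move=> Sx m nm; rewrite -(subnKC nm).
apply: le_trans (fast_cauchy_sqr_dist (fun j => g j x) n (m - n)) _.
rewrite ler_wpM2l ?mulr_ge0 ?exprn_ge0// -lee_fin -Sx -sumEFin.
rewrite subnKC// (le_trans _ (nneseries_lim_ge m _))//.
by rewrite [leRHS](big_cat_nat _ nm)//= leeDr// sume_ge0.
Qed.

Lemma fast_cauchy_L2_limit : exists2 h : T -> R, measurable_fun [set: T] h &
  forall n, (\int[mu]_x ((h x - g n x) ^+ 2)%:E <= (4 * 2^-1 ^+ n)%:E)%E.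
Proof.
(* An upper limit is measurable whether or not the sequence converges; [fine] only changes the value
   at points where [S] is infinite. *)
pose h x := fine (limn_esup (fun n => (g n x)%:E)).
have mh : measurable_fun [set: T] h.
  apply: measurableT_comp => //; apply: measurable_fun_limn_esup => n.
  exact/measurable_EFinP.
(* This holds at every point: where [S x] is infinite so is the right side, hence no exceptional set
   has to be removed. *)
have h_bound n x : (((h x - g n x) ^+ 2)%:E <= (2 * 2^-1 ^+ n)%:E * S x)%E.
  have S0 : (0 <= S x)%E by exact: nneseries_ge0.
  have c0 : 0 < 2 * 2^-1 ^+ n :> R by rewrite mulr_gt0 ?exprn_gt0.
  case Sx : (S x) S0 => [s| |] //; last first.
    by move=> _; rewrite gt0_muley// leey.
  rewrite lee_fin => s0; set r := Num.sqrt (2 * 2^-1 ^+ n * s).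
  have r2 : r ^+ 2 = 2 * 2^-1 ^+ n * s by rewrite sqr_sqrtr// mulr_ge0// ltW.
  have gr m : (n <= m)%N -> g n x - r <= g m x <= g n x + r.
    by move=> /(S_bound Sx)/ler_wsqrtr; rewrite sqrtr_sqr ler_norml -/r; lra.
  have hl : (limn_esup (fun n => (g n x)%:E) <= (g n x + r)%:E)%E.
    rewrite limn_esup_lim; apply: lime_le; first exact: is_cvg_esups.
    near=> m; apply: ge_ereal_sup => _ [k /= mk <-]; rewrite lee_fin.
    have nk : (n <= k)%N by apply: leq_trans mk; near: m; exists n.
    by case/andP: (gr k nk).
  have hr : ((g n x - r)%:E <= limn_esup (fun n => (g n x)%:E))%E.
    rewrite limn_esup_lim; apply: lime_ge; first exact: is_cvg_esups.
    near=> m; apply: ereal_sup_ge; exists (g m x)%:E; first by exists m => /=.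
    have nm : (n <= m)%N by near: m; exists n.
    by rewrite lee_fin; case/andP: (gr m nm).
  rewrite -EFinM lee_fin -r2; move: hl hr; rewrite /h.
  case: limn_esup => [l| |] //=; rewrite !lee_fin => hl hr.
  nra.
exists h => // n.
apply: (@le_trans _ _ (\int[mu]_x ((2 * 2^-1 ^+ n)%:E * S x))%E).
  apply: ge0_le_integral => //; first by move=> x _; rewrite lee_fin sqr_ge0.
    exact: measurable_diff2.
  exact: measurable_funeM.
rewrite ge0_integralZl//; last first.
  by move=> x _; exact: nneseries_ge0.
apply: le_trans (lee_wpmul2l _ int_S) _.
  by rewrite lee_fin mulr_ge0 ?exprn_ge0.
by rewrite -EFinM lee_fin; lra.
Unshelve. all: by end_near. Qed.

End L2complete.

(** * Smooth functions on the plane *)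

Section Slices.
Context {R : realType}.
Implicit Types (f g h : R * R -> R) (x y : R) (z v : R * R).

Let quot_ex f x y : (fun t : R => t^-1 *: ((f \o shift (x, y)) (t *: ex) - f (x, y)))
  = (fun t : R => t^-1 *: (((fun s => f (s, y)) \o shift x) (t *: 1) - f (x, y))).
Proof.
apply/funext => t /=; congr (_ *: (f _ - _)).
by congr pair; rewrite /= scaler0 add0r.
Qed.

Let quot_ey f x y : (fun t : R => t^-1 *: ((f \o shift (x, y)) (t *: ey) - f (x, y)))
  = (fun t : R => t^-1 *: (((fun s => f (x, s)) \o shift y) (t *: 1) - f (x, y))).
Proof.
apply/funext => t /=; congr (_ *: (f _ - _)).
by congr pair; rewrite /= scaler0 add0r.
Qed.

(** Passing to horizontal and vertical slices gives access to the one-variable mean value theorem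
    and the fundamental theorem of calculus. *)
Lemma derivable_ex f x y :
  derivable f (x, y) ex = derivable (fun s => f (s, y)) x 1.
Proof. by rewrite /derivable quot_ex. Qed.

Lemma derivable_ey f x y :
  derivable f (x, y) ey = derivable (fun s => f (x, s)) y 1.
Proof. by rewrite /derivable quot_ey. Qed.

Lemma derive_ex f x y : 'D_ex f (x, y) = 'D_1 (fun s => f (s, y)) x.
Proof. by rewrite /derive quot_ex. Qed.

Lemma derive_ey f x y : 'D_ey f (x, y) = 'D_1 (fun s => f (x, s)) y.
Proof. by rewrite /derive quot_ey. Qed.

End Slices.

(** * Symmetry of second derivatives *)

Section MixedPartials.
Context {R : realType}.

Lemma MVT_gt0 (f df : R -> R) (a s : R) : 0 < s ->
  (forall x : R, is_derive x 1 f (df x)) ->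
  exists2 c, a < c < a + s & f (a + s) - f a = df c * s.
Proof.
move=> s0 fdf; have [] := @MVT R f df a (a + s); first lra.
- by apply: derivable_within_continuous => x _; have [] := fdf x.
by move=> c; rewrite in_itv /= => ? ->; exists c => //; congr (_ * _); ring.
Qed.

(** The mean value theorem twice: for the increment of f in the second variable as a function of the
    first, then for [f1 a] in the second variable. *)
Lemma second_difference (f f1 f12 : R -> R -> R) (x y s : R) : 0 < s ->
  (forall a b : R, is_derive a 1 (f ^~ b) (f1 a b)) ->
  (forall a b : R, is_derive b 1 (f1 a) (f12 a b)) ->
  exists a b, [/\ x < a < x + s, y < b < y + s &
    f (x + s) (y + s) - f (x + s) y - f x (y + s) + f x y = f12 a b * s ^+ 2].
Proof.
move=> s0 df1 df12.
have [a xa Ea] := @MVT_gt0 (fun t => f t (y + s) - f t y)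
  (fun t => f1 t (y + s) - f1 t y) x _ s0 (fun t => is_deriveB _ _).
have [b yb Eb] := MVT_gt0 y s0 (df12 a).
by exists a, b; split => //; rewrite expr2 mulrA -Eb -Ea; ring.
Qed.

Let box_ball (x y s a b r : R) : x < a < x + s -> y < b < y + s -> s <= r ->
  ball (x, y) r (a, b).
Proof. by move=> ? ? ?; split; rewrite /ball/= ltr_distl; lra. Qed.

Lemma mixed_partials (f : R * R -> R) :
  (forall z, derivable f z ex) -> (forall z, derivable f z ey) ->
  (forall z, derivable (fun w => 'D_ex f w) z ey) ->
  (forall z, derivable (fun w => 'D_ey f w) z ex) ->
  continuous (fun z => 'D_ey (fun w => 'D_ex f w) z) ->
  continuous (fun z => 'D_ex (fun w => 'D_ey f w) z) ->
  forall z, 'D_ex (fun w => 'D_ey f w) z = 'D_ey (fun w => 'D_ex f w) z.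
Proof.
move=> dx dy dxy dyx cxy cyx [x y]; apply/eqP; rewrite -subr_eq0 -normr_le0.
apply/ler_addgt0Pr => e e0; rewrite add0r.
have e2 : 0 < e / 2 by lra.
have /cvgrPdist_le/(_ _ e2)/nbhs_ballP[r1 /= r10 B1] := cxy (x, y).
have /cvgrPdist_le/(_ _ e2)/nbhs_ballP[r2 /= r20 B2] := cyx (x, y).
pose s := Num.min r1 r2.
have s0 : 0 < s by rewrite lt_min r10.
have sr1 : s <= r1 by rewrite ge_min lexx.
have sr2 : s <= r2 by rewrite ge_min lexx orbT.
have [||a [b [xa yb Eab]]] := @second_difference (fun t u => f (t, u))
    (fun t u => 'D_ex f (t, u)) (fun t u => 'D_ey (fun w => 'D_ex f w) (t, u))
    x y s s0.
- move=> a b; rewrite derive_ex; apply: DeriveDef => //.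
  by have := dx (a, b); rewrite derivable_ex.
- move=> a b; rewrite derive_ey; apply: DeriveDef => //.
  by have := dxy (a, b); rewrite derivable_ey.
have [||b' [a' [yb' xa' Eab']]] := @second_difference (fun t u => f (u, t))
    (fun t u => 'D_ey f (u, t)) (fun t u => 'D_ex (fun w => 'D_ey f w) (u, t))
    y x s s0.
- move=> b' a'; rewrite derive_ey; apply: DeriveDef => //.
  by have := dy (a', b'); rewrite derivable_ey.
- move=> b' a'; rewrite derive_ex; apply: DeriveDef => //.
  by have := dyx (a', b'); rewrite derivable_ex.
(* The second difference over a square is symmetric in the two variables, so both mixed derivatives
   take the same value, at two possibly different points of that square. *)
have mid : 'D_ex (fun w => 'D_ey f w) (a', b') = 'D_ey (fun w => 'D_ex f w) (a, b).
  apply: (mulIf (x := s ^+ 2)); first by rewrite expf_neq0// gt_eqF.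
  by apply: etrans (etrans (esym Eab') _) Eab; congr (_ + _); rewrite addrAC.
rewrite [leRHS]splitr; apply: le_trans (ler_distD ('D_ex (fun w => 'D_ey f w) (a', b')) _ _) _.
apply: lerD; first by apply: B2; exact: box_ball xa' yb' sr2.
by rewrite mid distrC; apply: B1; exact: box_ball xa yb sr1.
Qed.

End MixedPartials.

Section Smooth.
Context {R : realType}.
Implicit Types (f g h : R * R -> R) (z v : R * R) (n : nat).

Definition smooth_real h := forall n, Ck n h.

Lemma CkW n h : Ck n.+1 h -> Ck n h.
Proof.
elim: n h => [|n IH] h [hc [dx dy cx cy]]; first exact: conj hc I.
exact: (conj hc (And4 dx dy (IH _ cx) (IH _ cy))).
Qed.

Lemma Ck_continuous n h : Ck n h -> continuous h.
Proof. by case: n => [|n] []. Qed.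

Lemma Ck_cst n (c : R) : Ck n (cst c).
Proof.
elim: n c => [|n IH] c; split => //=; try exact: cst_continuous.
split; try by move=> z; exact: derivable_cst.
  by rewrite (_ : (fun _ => _) = cst 0)//; apply/funext => z; rewrite derive_cst.
by rewrite (_ : (fun _ => _) = cst 0)//; apply/funext => z; rewrite derive_cst.
Qed.

Lemma CkD n f g : Ck n f -> Ck n g -> Ck n (fun z => f z + g z).
Proof.
elim: n f g => [|n IH] f g [fc Hf] [gc Hg]; (split;
  first by move=> z; apply: continuousD; [exact: fc | exact: gc]) => //.
case: Hf Hg => fx fy cfx cfy [gx gy cgx cgy].
split; try by move=> z; exact: derivableD.
  rewrite (_ : (fun _ => _) = (fun z => 'D_ex f z + 'D_ex g z)); first exact: IH.
  by apply/funext => z; rewrite deriveD.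
rewrite (_ : (fun _ => _) = (fun z => 'D_ey f z + 'D_ey g z)); first exact: IH.
by apply/funext => z; rewrite deriveD.
Qed.

Lemma CkM n f g : Ck n f -> Ck n g -> Ck n (fun z => f z * g z).
Proof.
elim: n f g => [|n IH] f g Cf Cg; case: (Cf) (Cg) => fc Hf [gc Hg]; (split;
  first by move=> z; apply: continuousM; [exact: fc | exact: gc]) => //.
case: Hf Hg => fx fy cfx cfy [gx gy cgx cgy].
have [Cf' Cg'] := (CkW Cf, CkW Cg).
split; try by move=> z; exact: derivableM.
  rewrite (_ : (fun _ => _) = (fun z => f z * 'D_ex g z + g z * 'D_ex f z)).
    by apply: CkD; exact: IH.
  by apply/funext => z; rewrite deriveM.
rewrite (_ : (fun _ => _) = (fun z => f z * 'D_ey g z + g z * 'D_ey f z)).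
  by apply: CkD; exact: IH.
by apply/funext => z; rewrite deriveM.
Qed.

Lemma smooth_real_continuous h : smooth_real h -> continuous h.
Proof. by move=> /(_ 0%N); exact: Ck_continuous. Qed.

Lemma smooth_real_derivable_ex h z : smooth_real h -> derivable h z ex.
Proof. by move=> /(_ 1%N)[_ []]. Qed.

Lemma smooth_real_derivable_ey h z : smooth_real h -> derivable h z ey.
Proof. by move=> /(_ 1%N)[_ []]. Qed.

Lemma smooth_real_ex h : smooth_real h -> smooth_real (fun z => 'D_ex h z).
Proof. by move=> sh n; have [_ []] := sh n.+1. Qed.

Lemma smooth_real_ey h : smooth_real h -> smooth_real (fun z => 'D_ey h z).
Proof. by move=> sh n; have [_ []] := sh n.+1. Qed.

Lemma smooth_real_cst (c : R) : smooth_real (fun=> c).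
Proof. by move=> n; exact: Ck_cst. Qed.

Lemma smooth_realD f g : smooth_real f -> smooth_real g ->
  smooth_real (fun z => f z + g z).
Proof. by move=> sf sg n; exact: CkD. Qed.

Lemma smooth_realM f g : smooth_real f -> smooth_real g ->
  smooth_real (fun z => f z * g z).
Proof. by move=> sf sg n; exact: CkM. Qed.

Lemma smooth_realN f : smooth_real f -> smooth_real (fun z => - f z).
Proof.
move=> sf; rewrite (_ : (fun _ => _) = (fun z => -1 * f z)).
  exact/smooth_realM/sf/smooth_real_cst.
by apply/funext => z; rewrite mulN1r.
Qed.

Lemma smooth_realB f g : smooth_real f -> smooth_real g ->
  smooth_real (fun z => f z - g z).
Proof. by move=> sf sg; apply: smooth_realD => //; exact: smooth_realN. Qed.

Let derive_fst : (forall z, 'D_ex (@fst R R) z = 1) /\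
  (forall z, 'D_ey (@fst R R) z = 0).
Proof.
split=> -[x y]; first by rewrite derive_ex /= derive_id.
by rewrite derive_ey derive_cst.
Qed.

Let derive_snd : (forall z, 'D_ex (@snd R R) z = 0) /\
  (forall z, 'D_ey (@snd R R) z = 1).
Proof.
split=> -[x y]; first by rewrite derive_ex derive_cst.
by rewrite derive_ey derive_id.
Qed.

Lemma derive_ex_fst z : 'D_ex (@fst R R) z = 1. Proof. exact: derive_fst.1. Qed.
Lemma derive_ey_fst z : 'D_ey (@fst R R) z = 0. Proof. exact: derive_fst.2. Qed.
Lemma derive_ex_snd z : 'D_ex (@snd R R) z = 0. Proof. exact: derive_snd.1. Qed.
Lemma derive_ey_snd z : 'D_ey (@snd R R) z = 1. Proof. exact: derive_snd.2. Qed.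

Lemma smooth_real_fst : smooth_real (@fst R R).
Proof.
have c : continuous (@fst R R) by move=> z; exact: cvg_fst.
case=> [|n]; split => //; split.
- by move=> [x y]; rewrite derivable_ex; exact: derivable_id.
- by move=> [x y]; rewrite derivable_ey; exact: derivable_cst.
- by under eq_fun do rewrite derive_ex_fst; exact: Ck_cst.
- by under eq_fun do rewrite derive_ey_fst; exact: Ck_cst.
Qed.

Lemma smooth_real_snd : smooth_real (@snd R R).
Proof.
have c : continuous (@snd R R) by move=> z; exact: cvg_snd.
case=> [|n]; split => //; split.
- by move=> [x y]; rewrite derivable_ex; exact: derivable_cst.
- by move=> [x y]; rewrite derivable_ey; exact: derivable_id.
- by under eq_fun do rewrite derive_ex_snd; exact: Ck_cst.
- by under eq_fun do rewrite derive_ey_snd; exact: Ck_cst.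
Qed.

(** [Ck] requires the two mixed derivatives separately and says nothing of their equality, which the
    commutation of d and dbar rests on. *)
Lemma smooth_real_mixed h z : smooth_real h ->
  'D_ex (fun w => 'D_ey h w) z = 'D_ey (fun w => 'D_ex h w) z.
Proof.
move=> sh; have [sx sy] := (smooth_real_ex sh, smooth_real_ey sh).
apply: mixed_partials => {z} [z|z|z|z||].
- exact: smooth_real_derivable_ex.
- exact: smooth_real_derivable_ey.
- exact: smooth_real_derivable_ey.
- exact: smooth_real_derivable_ex.
- exact/smooth_real_continuous/smooth_real_ey.
- exact/smooth_real_continuous/smooth_real_ex.
Qed.

Definition coweight z : R := expR (z.1 ^+ 2 + z.2 ^+ 2).

Lemma coweight_gt0 z : 0 < coweight z. Proof. exact: expR_gt0. Qed.

Lemma coweightK z : coweight z * weight z = 1.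
Proof. by rewrite -expRD subrr expR0. Qed.

Let is_derive_expsq (a x : R) :
  is_derive x 1 (fun s => expR (s ^+ 2 + a)) (2 * x * expR (x ^+ 2 + a)).
Proof.
have d : is_derive x (1 : R) (fun s => s ^+ 2 + a : R) (2 * x).
  apply: is_derive_eq; rewrite /GRing.scale/=. by rewrite !mulr1 addr0 mulr_natl mulr2n.
by apply: is_derive_eq; rewrite /GRing.scale/= mulrC.
Qed.

Let is_derive_coweight z : is_derive z ex coweight (2 * z.1 * coweight z) /\
  is_derive z ey coweight (2 * z.2 * coweight z).
Proof.
case: z => x y; split; apply: DeriveDef.
- by rewrite derivable_ex /coweight /=; have [] := is_derive_expsq (y ^+ 2) x.
- by rewrite derive_ex /coweight /=; have [] := is_derive_expsq (y ^+ 2) x.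
- rewrite derivable_ey /coweight /=; under eq_fun do rewrite addrC.
  by have [] := is_derive_expsq (x ^+ 2) y.
- rewrite derive_ey /coweight /=; under eq_fun do rewrite addrC.
  by rewrite addrC; have [] := is_derive_expsq (x ^+ 2) y.
Qed.

Lemma derive_ex_coweight z : 'D_ex coweight z = 2 * z.1 * coweight z.
Proof. by have [[]] := is_derive_coweight z. Qed.

Lemma derive_ey_coweight z : 'D_ey coweight z = 2 * z.2 * coweight z.
Proof. by have [_ []] := is_derive_coweight z. Qed.

(** Each partial derivative is a linear function times [coweight] itself, so order n+1 follows from
    order n and the product rule. *)
Lemma smooth_real_coweight : smooth_real coweight.
Proof.
have c : continuous coweight.
  move=> z; apply: continuous_comp; last exact: continuous_expR.
  by apply: smooth_real_continuous; apply: smooth_realD; apply: smooth_realM;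
    (exact: smooth_real_fst || exact: smooth_real_snd).
elim=> [|n IH]; split => //; split.
- by move=> z; have [[]] := is_derive_coweight z.
- by move=> z; have [_ []] := is_derive_coweight z.
- under eq_fun do rewrite derive_ex_coweight; apply: CkM => //.
  by apply: CkM; [exact: Ck_cst | exact: smooth_real_fst].
- under eq_fun do rewrite derive_ey_coweight; apply: CkM => //.
  by apply: CkM; [exact: Ck_cst | exact: smooth_real_snd].
Qed.

End Smooth.

(** * Integration over the plane *)

Section PlaneIntegral.
Context {R : realType}.
Implicit Types (h f g : R * R -> R).
Notation leb := (@lebesgue_measure R).

(** Open refers to the product topology and measurable to the product sigma-algebra; a countable
    union of squares with rational centre and radius links the two. *)
Lemma open_plane_measurable (K : set (R * R)) :
  open K -> measurable (K : set (plane R)).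
Proof.
move=> oK.
pose box (q : rat * rat * rat) : set (R * R) :=
  ball (ratr q.1.1 : R, ratr q.1.2 : R) (ratr q.2).
pose D : set (rat * rat * rat) := [set q | box q `<=` K].
suff -> : K = \bigcup_(q in D) box q.
  rewrite bigcup_mkcond; apply: countable_bigcupT_measurable => // q.
  by case: ifP => // _; apply: measurableX; exact: measurable_ball.
apply/seteqP; split => [[x y] Kxy|z [q Dq]]; last exact: Dq.
have /nbhs_ballP[e /= e0 eK] := open_nbhs_nbhs (conj oK Kxy).
have /rat_in_itvoo[d] : 0 < e / 2 by rewrite divr_gt0.
have approx (t r : R) : 0 < r -> exists q, `|t - ratr q| < r.
  move=> r0; have /rat_in_itvoo[q] : t < t + r by rewrite ltrDl.
  by rewrite in_itv/= => /andP[tq qr]; exists q; rewrite ltr_distl; lra.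
rewrite in_itv/= => /andP[d0 de].
have [p xp] := approx x _ d0; have [q yq] := approx y _ d0.
exists (p, q, d); last by split; rewrite /ball/= distrC.
move=> [u v] [] /=; rewrite /ball/= => up vq; apply: eK.
have tri (a b c : R) : `|a - b| < ratr d -> `|b - c| < ratr d -> `|a - c| < e.
  by move=> ab bc; apply: le_lt_trans (ler_distD b _ _) _; lra.
by split; rewrite /ball/=; [exact: tri xp up | exact: tri yq vq].
Qed.

Lemma continuous_plane_measurable h : continuous h ->
  measurable_fun [set: plane R] h.
Proof.
move=> /continuousP ch; apply: (measurability _ (RGenOpens.measurableE R)).
move=> _ [_ [a [b ->] <-]]; rewrite setTI.
by apply: open_plane_measurable; apply: ch; exact: interval_open.
Qed.

(** A square replaces the compact closure used for test functions: this form passes directly to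
    products, sums, derivatives and one-dimensional slices. *)
Definition bounded_support h :=
  exists M : R, forall z, h z != 0 -> `|z.1| <= M /\ `|z.2| <= M.

Lemma bounded_supportS h f :
  (forall z, f z != 0 -> h z != 0) -> bounded_support h -> bounded_support f.
Proof. by move=> fh [M hM]; exists M => z /fh; exact: hM. Qed.

Lemma compact_bounded_support h K : compact K ->
  (forall z, h z != 0 -> K z) -> bounded_support h.
Proof.
move=> /compact_bounded[M [_ KM]] hK; exists (M + 1) => z /hK /KM /=.
move=> /(_ (M + 1)); rewrite ltrDl ltr01 => /(_ isT).
by rewrite prod_normE/= ge_max => /andP.
Qed.

Let in_segment (M x : R) : `[- M, M]%classic x <-> `|x| <= M.
Proof. by rewrite /= in_itv/= ler_norml. Qed.

Lemma continuous_bounded_support_integrable h :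
  continuous h -> bounded_support h -> (@area R).-integrable setT (EFin \o h).
Proof.
move=> ch [M hM]; pose I := `[- M, M]%classic; pose K := (I `*` I : set (R * R)).
have cK : compact K by apply: compact_setX; exact: segment_compact.
have mK : measurable (K : set (plane R)) by apply: measurableX; exact: measurable_itv.
have -> : EFin \o h = (EFin \o h) \_ K.
  apply/funext => z; rewrite patchE; case: ifPn => // /negP zK /=.
  congr EFin; apply/eqP/negPn/negP => /hM[z1 z2]; apply: zK.
  by rewrite inE; split; apply/in_segment.
apply/(integrable_mkcond _ mK); apply: measurable_bounded_integrable => //.
- have -> : @area R K = (leb I * leb I)%E.
    by apply: product_measure1E; exact: measurable_itv.
  by rewrite !lebesgue_measure_itv/=; case: ifP; rewrite -?EFinB -?EFinM ltry.
- apply: measurable_funS (continuous_plane_measurable ch) => //.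
- have /compact_bounded[B [Breal BP]] : compact (h @` K).
    by apply: continuous_compact => //; exact: continuous_subspaceT.
  by exists B; split => // B' BB' z Kz; apply: BP BB' _ _; exists z.
Qed.

Let continuous_derive_x h (y : R) : continuous (fun z => 'D_ex h z) ->
  continuous (fun x : R => 'D_1 (fun t => h (t, y)) x).
Proof.
move=> cf x; under eq_fun do rewrite -derive_ex.
have c : (fun s : R => (s, y)) @ x --> (x, y).
  by apply: (cvg_pair (G := nbhs x) (H := nbhs y)); [exact: cvg_id | exact: cvg_cst].
exact: (cvg_comp _ _ c (cf (x, y))).
Qed.

Let continuous_derive_y h (x : R) : continuous (fun z => 'D_ey h z) ->
  continuous (fun y : R => 'D_1 (fun t => h (x, t)) y).
Proof.
move=> cf y; under eq_fun do rewrite -derive_ey.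
have c : (fun s : R => (x, s)) @ y --> (x, y).
  by apply: (cvg_pair (G := nbhs x) (H := nbhs y)); [exact: cvg_cst | exact: cvg_id].
exact: (cvg_comp _ _ c (cf (x, y))).
Qed.

Let integral_derive1 (u : R -> R) (M : R) :
  (forall x : R, derivable u x 1) -> continuous (fun x : R => 'D_1 u x) ->
  (forall x, u x != 0 -> `|x| <= M) -> (\int[leb]_x ('D_1 u x)%:E = 0)%E.
Proof.
move=> du cdu uM.
have u0 x : M < `|x| -> u x = 0.
  by move=> Mx; apply/eqP/negPn/negP => /uM; rewrite leNgt Mx.
have du0 x : M < `|x| -> 'D_1 u x = 0.
  move=> Mx; rewrite -(derive_cst (0 : R) x 1); apply: near_eq_derive.
  have : \forall y \near x, M < `|y|.
    have c : (fun y : R => `|y|) @ x --> `|x| by exact: norm_continuous.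
    exact: (cvgr_gt _ c _ Mx).
  by apply: filterS => y /u0.
(* The endpoints must lie strictly outside the support and satisfy -a < a, although [M] may be
   negative. *)
pose a := `|M| + 1.
have Ma : M < a by have := ler_norm M; rewrite /a; lra.
have a0 : 0 < a by have := normr_ge0 M; rewrite /a; lra.
have cu : continuous u.
  by move=> x; apply/differentiable_continuous/derivable1_diffP; exact: du.
have -> : (\int[leb]_x ('D_1 u x)%:E = \int[leb]_(x in `[(- a)%R, a]) ('D_1 u x)%:E)%E.
  rewrite [RHS]integral_mkcond; apply: eq_integral => x _; rewrite patchE.
  case: ifPn => // /negP xa; rewrite du0// ltNge; apply/negP => xM; apply: xa.
  by rewrite inE; apply/in_segment; rewrite (le_trans xM)// ltW.
rewrite (@continuous_FTC2 _ _ u).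
- by rewrite !u0 ?normrN ?gtr0_norm// subee.
- lra.
- exact: continuous_subspaceT.
- split => [x _||]; first exact: du.
    by apply: cvg_at_right_filter; exact: cu.
  by apply: cvg_at_left_filter; exact: cu.
- by move=> x _; rewrite derive1E.
Qed.

Let derive_bounded_support h v : v = ex \/ v = ey -> bounded_support h ->
  bounded_support (fun z => 'D_v h z).
Proof.
move=> v_xy [M hM]; exists M => z dz; apply/andP; apply: contraT.
rewrite negb_and -!ltNge => Mz; case/eqP: dz.
rewrite -(derive_cst (0 : R) z v); apply: near_eq_derive.
have h0 w : (M < `|w.1|) || (M < `|w.2|) -> h w = 0.
  by rewrite !ltNge -negb_and => wM; apply/eqP/negPn/negP => /hM/andP; apply/negP.
have [z1|z2] := orP Mz.
  have : \forall w \near z, M < `|w.1|.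
    have c : (fun w : R * R => `|w.1|) @ z --> `|z.1|.
      by apply: cvg_norm; exact: cvg_fst.
    exact: (cvgr_gt _ c _ z1).
  by apply: filterS => w w1; rewrite h0// w1.
have : \forall w \near z, M < `|w.2|.
  have c : (fun w : R * R => `|w.2|) @ z --> `|z.2|.
      by apply: cvg_norm; exact: cvg_snd.
    exact: (cvgr_gt _ c _ z2).
by apply: filterS => w w1; rewrite h0// w1 orbT.
Qed.

Lemma derive_ex_bounded_support h : bounded_support h ->
  bounded_support (fun z => 'D_ex h z).
Proof. by apply: derive_bounded_support; left. Qed.

Lemma derive_ey_bounded_support h : bounded_support h ->
  bounded_support (fun z => 'D_ey h z).
Proof. by apply: derive_bounded_support; right. Qed.

(** By Fubini the variable of differentiation is integrated first, and each slice gives 0 by the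
    fundamental theorem of calculus. *)
Lemma Rintegral_derive_ex h : smooth_real h -> bounded_support h ->
  \int[@area R]_z 'D_ex h z = 0.
Proof.
move=> sh bh; have [M hM] := bh.
have cdh := smooth_real_continuous (smooth_real_ex sh).
have ih := continuous_bounded_support_integrable cdh (derive_ex_bounded_support bh).
rewrite /Rintegral -[X in fine X](integral21_prod_meas1 ih).
rewrite integral0_eq// => y _.
transitivity (\int[leb]_s ('D_1 (fun t => h (t, y)) s)%:E)%E.
  by apply: eq_integral => s _ /=; rewrite derive_ex.
apply: (integral_derive1 (M := M)) => [x|x|x].
- by have : derivable h (x, y) ex := smooth_real_derivable_ex sh; rewrite derivable_ex.
- exact: continuous_derive_x.
- by move=> /hM[].
Qed.

Lemma Rintegral_derive_ey h : smooth_real h -> bounded_support h ->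
  \int[@area R]_z 'D_ey h z = 0.
Proof.
move=> sh bh; have [M hM] := bh.
have cdh := smooth_real_continuous (smooth_real_ey sh).
have ih := continuous_bounded_support_integrable cdh (derive_ey_bounded_support bh).
rewrite /Rintegral -[X in fine X](integral12_prod_meas1 ih).
rewrite integral0_eq// => x _.
transitivity (\int[leb]_s ('D_1 (fun t => h (x, t)) s)%:E)%E.
  by apply: eq_integral => s _ /=; rewrite derive_ey.
apply: (integral_derive1 (M := M)) => [y|y|y].
- by have : derivable h (x, y) ey := smooth_real_derivable_ey sh; rewrite derivable_ey.
- exact: continuous_derive_y.
- by move=> /hM[].
Qed.

End PlaneIntegral.

(** * Test functions and Wirtinger derivatives *)

Section Wirtinger.
Context {R : realType}.
Implicit Types (phi psi : R * R -> R[i]) (z v : R * R) (a : R[i]).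

Lemma complexE_mul (x y : R[i]) :
  x * y = (Re x * Re y - Im x * Im y) +i* (Re x * Im y + Im x * Re y).
Proof. by case: x y => [? ?] [? ?]. Qed.

Lemma complex_ext (x y : R[i]) : Re x = Re y -> Im x = Im y -> x = y.
Proof. by case: x y => [? ?] [? ?] /= -> ->. Qed.

(* [coordz 1] is z and [coordz (-1)] is its conjugate. *)
Definition coordz (t : R) z : R[i] := z.1 +i* (t * z.2).

(** [Ck] provides derivability along the two axes only. *)
Definition directional v := v = ex \/ v = ey.

Lemma smooth_real_dir_derivable (h : R * R -> R) v z :
  directional v -> smooth_real h -> derivable h z v.
Proof.
by case=> ->; [exact: smooth_real_derivable_ex|exact: smooth_real_derivable_ey].
Qed.

Lemma smooth_real_dir (h : R * R -> R) v :
  directional v -> smooth_real h -> smooth_real (fun z => 'D_v h z).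
Proof. by case=> ->; [exact: smooth_real_ex | exact: smooth_real_ey]. Qed.

Lemma smoothP phi : smooth phi <->
  smooth_real (fun z => Re (phi z)) /\ smooth_real (fun z => Im (phi z)).
Proof.
by split=> [s|[s1 s2] n]; [split=> n; have [] := s n | split].
Qed.

Lemma smooth_pderive v phi : directional v -> smooth phi -> smooth (pderive v phi).
Proof.
by move=> dv /smoothP[s1 s2]; apply/smoothP; split; exact: smooth_real_dir.
Qed.

Lemma smooth_lin a phi psi : smooth phi -> smooth psi ->
  smooth (fun z => a * phi z + psi z).
Proof.
move=> /smoothP[p1 p2] /smoothP[q1 q2]; apply/smoothP; split.
  rewrite (_ : (fun _ => _) =
      (fun z => (Re a * Re (phi z) - Im a * Im (phi z)) + Re (psi z))).
    apply: smooth_realD => //; apply: smooth_realB; apply: smooth_realM => //;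
    exact: smooth_real_cst.
  by apply/funext => z; rewrite complexE_mul; case: (psi z).
rewrite (_ : (fun _ => _) =
    (fun z => (Re a * Im (phi z) + Im a * Re (phi z)) + Im (psi z))).
  apply: smooth_realD => //; apply: smooth_realD; apply: smooth_realM => //;
  exact: smooth_real_cst.
by apply/funext => z; rewrite complexE_mul; case: (psi z).
Qed.

Lemma smooth_mul phi psi : smooth phi -> smooth psi ->
  smooth (fun z => phi z * psi z).
Proof.
move=> /smoothP[p1 p2] /smoothP[q1 q2]; apply/smoothP; split.
  rewrite (_ : (fun _ => _) =
      (fun z => Re (phi z) * Re (psi z) - Im (phi z) * Im (psi z))).
    by apply: smooth_realB; exact: smooth_realM.
  by apply/funext => z; rewrite complexE_mul.
rewrite (_ : (fun _ => _) =
    (fun z => Re (phi z) * Im (psi z) + Im (phi z) * Re (psi z))).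
  by apply: smooth_realD; exact: smooth_realM.
by apply/funext => z; rewrite complexE_mul.
Qed.

Lemma smooth_coordz t : smooth (coordz t).
Proof.
apply/smoothP; split; first exact: smooth_real_fst.
by apply: smooth_realM; [exact: smooth_real_cst | exact: smooth_real_snd].
Qed.

Let leibniz_alg (x y : R[i]) (a b c d : R) :
  (Re x *: c + Re y *: a - (Im x *: d + Im y *: b)) +i*
  (Re x *: d + Im y *: a + (Im x *: c + Re y *: b)) =
  (a +i* b) * y + x * (c +i* d).
Proof.
by apply: complex_ext; rewrite !complexE_mul /= /GRing.scale/=; ring.
Qed.

Lemma pderive_mul v phi psi z : directional v -> smooth phi -> smooth psi ->
  pderive v (fun w => phi w * psi w) z =
  pderive v phi z * psi z + phi z * pderive v psi z.
Proof.
move=> dv /smoothP[p1 p2] /smoothP[q1 q2]; rewrite /pderive.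
have d h w := @smooth_real_dir_derivable h v w dv.
rewrite (_ : (fun w => Re (phi w * psi w)) =
    (fun w => Re (phi w) * Re (psi w)) - (fun w => Im (phi w) * Im (psi w))).
  rewrite (_ : (fun w => Im (phi w * psi w)) =
      (fun w => Re (phi w) * Im (psi w)) + (fun w => Im (phi w) * Re (psi w))).
    have dM f g : smooth_real f -> smooth_real g ->
        derivable (fun w => f w * g w) z v.
      by move=> sf sg; apply: d; exact: smooth_realM.
    rewrite deriveB ?deriveD; try exact: dM.
    rewrite !deriveM; try exact: d.
    exact: leibniz_alg.
  by apply/funext => w; rewrite complexE_mul.
by apply/funext => w; rewrite complexE_mul.
Qed.

Lemma pderive_add v phi psi z : directional v -> smooth phi -> smooth psi ->
  pderive v (fun w => phi w + psi w) z = pderive v phi z + pderive v psi z.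
Proof.
move=> dv /smoothP[p1 p2] /smoothP[q1 q2].
apply: complex_ext; rewrite [LHS]/=.
  rewrite (_ : (fun w => _) = (fun w => Re (phi w)) + (fun w => Re (psi w))).
    by rewrite deriveD//; exact: smooth_real_dir_derivable.
  by apply/funext => w; rewrite -[RHS]/(Re (phi w) + Re (psi w)); case: (phi w) (psi w) => [? ?] [].
rewrite (_ : (fun w => _) = (fun w => Im (phi w)) + (fun w => Im (psi w))).
  by rewrite deriveD//; exact: smooth_real_dir_derivable.
by apply/funext => w; rewrite -[RHS]/(Im (phi w) + Im (psi w)); case: (phi w) (psi w) => [? ?] [].
Qed.

Lemma pderive_lin v a phi psi z : directional v -> smooth phi -> smooth psi ->
  pderive v (fun w => a * phi w + psi w) z =
  a * pderive v phi z + pderive v psi z.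
Proof.
move=> dv sp sq.
have sa : smooth (fun=> a) by apply/smoothP; split; exact: smooth_real_cst.
rewrite pderive_add//; last exact: smooth_mul.
by rewrite pderive_mul// /pderive !derive_cst mul0r add0r.
Qed.

Lemma pderive_mixed phi z : smooth phi ->
  pderive ex (pderive ey phi) z = pderive ey (pderive ex phi) z.
Proof.
by move=> /smoothP[s1 s2]; apply: complex_ext;
  [exact: (smooth_real_mixed z s1) | exact: (smooth_real_mixed z s2)].
Qed.

Lemma pderive_ex_coordz t z : pderive ex (coordz t) z = 1.
Proof.
apply: complex_ext; first exact: derive_ex_fst.
rewrite /= (_ : (fun _ => _) = t *: @snd R R)//.
by rewrite deriveZ ?derive_ex_snd ?scaler0//;
  exact/smooth_real_derivable_ex/smooth_real_snd.
Qed.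

Lemma pderive_ey_coordz t z : pderive ey (coordz t) z = 0 +i* t.
Proof.
apply: complex_ext; first exact: derive_ey_fst.
rewrite /= (_ : (fun _ => _) = t *: @snd R R)//.
rewrite deriveZ; last exact/smooth_real_derivable_ey/smooth_real_snd.
by rewrite derive_ey_snd /GRing.scale/= mulr1.
Qed.

Let supp phi := closure [set z | phi z != 0].

Lemma compact_suppS phi K : compact K -> (forall z, phi z != 0 -> K z) ->
  compact (supp phi).
Proof.
move=> cK pK; apply: (subclosed_compact _ cK); first exact: closed_closure.
have /closure_id -> : closed K.
  by apply: compact_closed => //; exact: norm_hausdorff.
exact: closure_subset.
Qed.

Lemma pderive_supp v phi z : pderive v phi z != 0 -> supp phi z.
Proof.
move=> dz; apply: contrapT => nz; case/eqP: dz.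
have : \forall w \near z, phi w = 0.
  have : nbhs z (~` supp phi).
    apply: open_nbhs_nbhs; split => //; rewrite openC; exact: closed_closure.
  apply: filterS => w /= nw; apply/eqP/negPn/negP => pw.
  by apply: nw; exact: subset_closure.
move=> nz0; rewrite /pderive; apply: complex_ext => /=;
  rewrite -(derive_cst (0 : R) z v); apply: near_eq_derive;
  by apply: filterS nz0 => w ->.
Qed.

End Wirtinger.

(** * The module of test functions and the operators acting on it *)

Section TestFunctions.
Context {R : realType}.
Implicit Types (f g : R * R -> R[i]).

Definition test_pred : {pred (R * R -> R[i])} := mem [set f | @test_function R f].

Lemma test_submod_closed : submod_closed test_pred.
Proof.
split=> [|a f g]; rewrite !inE.
  split.
    by apply/smoothP; split; exact: smooth_real_cst.
  apply: (compact_suppS (compact0)) => z; by rewrite eqxx.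
move=> [sf cf] [sg cg]; split; first exact: smooth_lin.
apply: (compact_suppS (compactU cf cg)) => z fgz; apply: contrapT.
move=> /not_orP[nf ng]; move/eqP: fgz; apply.
have z0 (h : R * R -> R[i]) : ~ closure [set z | h z != 0] z -> h z = 0.
  by move=> nh; apply/eqP/negPn/negP => hz; apply: nh; exact: subset_closure.
by rewrite -[LHS]/(a * f z + g z) !z0// mulr0 addr0.
Qed.

End TestFunctions.

HB.instance Definition _ (R : realType) :=
  GRing.isSubmodClosed.Build R[i] (R * R -> R[i]) (@test_pred R)
    (@test_submod_closed R).

(** Bundling turns test functions into an [lmodType], on which the ladder lemmas can take d and dbar
    as linear endomorphisms. *)
Record testfun (R : realType) :=
  MkTestfun { testfun_val :> R * R -> R[i] ; _ : testfun_val \in @test_pred R }.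

HB.instance Definition _ (R : realType) := [isSub for @testfun_val R].
HB.instance Definition _ (R : realType) := [Choice of testfun R by <:].
HB.instance Definition _ (R : realType) :=
  [SubChoice_isSubLmodule of testfun R by <:].

Section TestOperators.
Context {R : realType}.
Implicit Types (phi psi : testfun R) (z v : R * R) (a : R[i]).

Lemma testfunP phi : test_function phi.
Proof. by case: phi => f /=; rewrite inE. Qed.

Lemma testfun_smooth phi : smooth phi. Proof. exact: (testfunP phi).1. Qed.

Lemma testfun_ext phi psi : phi =1 psi -> phi = psi.
Proof. by move=> e; apply: val_inj; apply/funext. Qed.

Lemma testfun_lin a phi psi z : (a *: phi + psi) z = a * phi z + psi z.
Proof. by []. Qed.

(** The closure is essential for derivatives, which may be nonzero at a zero of [phi] on the
    boundary of its support. *)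
Lemma testfun_subproof f (phi : testfun R) : smooth f ->
  (forall z, f z != 0 -> closure [set w | phi w != 0] z) -> f \in @test_pred R.
Proof.
move=> sf fp; rewrite inE; split => //.
by apply: compact_suppS fp; exact: (testfunP phi).2.
Qed.

Definition tderive_ex phi : testfun R := MkTestfun
  (testfun_subproof (smooth_pderive (or_introl erefl) (testfun_smooth phi))
    (pderive_supp (phi := phi))).

Definition tderive_ey phi : testfun R := MkTestfun
  (testfun_subproof (smooth_pderive (or_intror erefl) (testfun_smooth phi))
    (pderive_supp (phi := phi))).

Lemma tmul_subproof (f : R * R -> R[i]) phi : smooth f ->
  (fun z => f z * phi z) \in @test_pred R.
Proof.
move=> sf; apply: (@testfun_subproof _ phi).
  exact/smooth_mul/testfun_smooth.
move=> z; rewrite mulf_eq0 negb_or => /andP[_ pz].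
by apply: (@subset_closure _ [set w | phi w != 0]).
Qed.

Definition tmul (t : R) phi : testfun R :=
  MkTestfun (tmul_subproof phi (smooth_coordz t)).

Lemma tderive_ex_linear : linear tderive_ex.
Proof.
move=> a phi psi; apply: testfun_ext => z /=.
by rewrite pderive_lin//; [left | exact: testfun_smooth | exact: testfun_smooth].
Qed.

Lemma tderive_ey_linear : linear tderive_ey.
Proof.
move=> a phi psi; apply: testfun_ext => z /=.
by rewrite pderive_lin//; [right | exact: testfun_smooth | exact: testfun_smooth].
Qed.

HB.instance Definition _ :=
  GRing.isLinear.Build R[i] (testfun R) (testfun R) _ tderive_ex tderive_ex_linear.
HB.instance Definition _ :=
  GRing.isLinear.Build R[i] (testfun R) (testfun R) _ tderive_ey tderive_ey_linear.

Lemma tderiveC phi : tderive_ex (tderive_ey phi) = tderive_ey (tderive_ex phi).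
Proof. by apply: testfun_ext => z; exact/pderive_mixed/testfun_smooth. Qed.

Lemma tderive_ex_mul t phi : tderive_ex (tmul t phi) = phi + tmul t (tderive_ex phi).
Proof.
apply: testfun_ext => z.
rewrite -[LHS]/(pderive ex (fun w => coordz t w * phi w) z) pderive_mul; last 3 first.
- by left.
- exact: smooth_coordz.
- exact: testfun_smooth.
by rewrite pderive_ex_coordz mul1r.
Qed.

Lemma tderive_ey_mul t phi :
  tderive_ey (tmul t phi) = (0 +i* t) *: phi + tmul t (tderive_ey phi).
Proof.
apply: testfun_ext => z.
rewrite -[LHS]/(pderive ey (fun w => coordz t w * phi w) z) pderive_mul; last 3 first.
- by right.
- exact: smooth_coordz.
- exact: testfun_smooth.
by rewrite pderive_ey_coordz.
Qed.

(* [tdir (-1)] and [tdir 1] are the Wirtinger derivatives d_z and d_zbar, and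
   [tadj (-1)], [tadj 1] their adjoints for the weight exp(|z|^2). *)
Definition tdir (s : R) phi : testfun R :=
  2^-1 *: tderive_ex phi + (0 +i* (s / 2)) *: tderive_ey phi.

Definition tadj (s : R) phi : testfun R := - (tdir (- s) phi + tmul (- s) phi).

Lemma tdirE s phi z : tdir s phi z =
  2^-1 * tderive_ex phi z + (0 +i* (s / 2)) * tderive_ey phi z.
Proof. by []. Qed.

Lemma tdir_linear s : linear (tdir s).
Proof.
move=> a phi psi; apply: testfun_ext => z.
rewrite [RHS]testfun_lin !tdirE tderive_ex_linear tderive_ey_linear !testfun_lin.
move: (tderive_ex _ _) (tderive_ey _ _) (tderive_ex _ _) (tderive_ey _ _).
by move=> ? ? ? ?; ring.
Qed.

HB.instance Definition _ s :=
  GRing.isLinear.Build R[i] (testfun R) (testfun R) _ (tdir s) (tdir_linear s).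

Lemma tdirC s t phi : tdir s (tdir t phi) = tdir t (tdir s phi).
Proof.
apply: testfun_ext => z; rewrite [LHS]tdirE [RHS]tdirE.
have DX r : tderive_ex (tdir r phi) z = 2^-1 * tderive_ex (tderive_ex phi) z +
    (0 +i* (r / 2)) * tderive_ex (tderive_ey phi) z.
  by rewrite [tdir r phi]/tdir (linearD tderive_ex) !(linearZ_LR tderive_ex).
have DY r : tderive_ey (tdir r phi) z = 2^-1 * tderive_ex (tderive_ey phi) z +
    (0 +i* (r / 2)) * tderive_ey (tderive_ey phi) z.
  by rewrite [tdir r phi]/tdir (linearD tderive_ey) !(linearZ_LR tderive_ey) tderiveC.
have step r q : 2^-1 * tderive_ex (tdir r phi) z + q * tderive_ey (tdir r phi) z =
    2^-1 * (2^-1 * tderive_ex (tderive_ex phi) z +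
      (0 +i* (r / 2)) * tderive_ex (tderive_ey phi) z) +
    q * (2^-1 * tderive_ex (tderive_ey phi) z +
      (0 +i* (r / 2)) * tderive_ey (tderive_ey phi) z).
  by congr (_ * _ + _ * _).
apply: etrans (step t _) (etrans _ (esym (step s _))).
move: (tderive_ex (tderive_ex phi) z) (tderive_ex (tderive_ey phi) z).
move: (tderive_ey (tderive_ey phi) z) (0 +i* (s / 2)) (0 +i* (t / 2)).
by move=> ? ? ? ? ?; ring.
Qed.

(** The scalar is the derivative of [coordz t] under [tdir s]. For signs s and t it is 1 when t = -s
    (d of z, dbar of conj z) and 0 when t = s, which yields all the commutation relations. *)
Lemma tdir_mul s t phi :
  tdir s (tmul t phi) = tmul t (tdir s phi) + ((1 - s * t) / 2)%:C *: phi.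
Proof.
apply: testfun_ext => z; rewrite addrC [RHS]testfun_lin [LHS]tdirE.
rewrite tderive_ex_mul tderive_ey_mul.
rewrite -[X in 2^-1 * X]/(phi z + coordz t z * tderive_ex phi z).
rewrite -[X in (_ +i* (s / 2)) * X]/
  ((0 +i* t) * phi z + coordz t z * tderive_ey phi z).
rewrite -[X in _ = _ + X]/(coordz t z *
  (2^-1 * tderive_ex phi z + (0 +i* (s / 2)) * tderive_ey phi z)).
have -> : ((1 - s * t) / 2)%:C = 2^-1 + (0 +i* (s / 2)) * (0 +i* t).
  rewrite complexE_mul (_ : 2^-1 = (2^-1)%:C); last by rewrite fmorphV rmorph_nat.
  by apply: complex_ext; rewrite /=; field.
move: (phi z) (coordz t z) (tderive_ex phi z) (tderive_ey phi z).
move: (0 +i* (s / 2)) (0 +i* t) => ? ? ? ? ? ?.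
by ring.
Qed.

Let tdirN s phi : tdir s (- phi) = - tdir s phi.
Proof. exact: (linearN (tdir s)). Qed.
Let tdirD s phi psi : tdir s (phi + psi) = tdir s phi + tdir s psi.
Proof. exact: (linearD (tdir s)). Qed.
Lemma tadj_tdir s phi : s ^+ 2 = 1 ->
  tadj s (tdir s phi) = tdir s (tadj s phi) + phi.
Proof.
move=> s2; rewrite /tadj tdirN tdirD tdir_mul.
rewrite mulrN opprK -expr2 s2 -[1 + 1]/(2 : R) divff ?pnatr_eq0// scale1r.
by rewrite (tdirC s) [in RHS]addrA [in RHS]opprD addrNK.
Qed.

Lemma tadj_tdirN s phi : s ^+ 2 = 1 ->
  tadj s (tdir (- s) phi) = tdir (- s) (tadj s phi).
Proof.
move=> s2; rewrite /tadj tdirN tdirD tdir_mul.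
by rewrite mulrNN -expr2 s2 subrr mul0r scale0r addr0.
Qed.

End TestOperators.

(** * Integration by parts against exp(|z|^2) *)

Section AdjointIntegral.
Context {R : realType}.
Implicit Types (h a b p q : R * R -> R).

Lemma Rintegral_derive_pair (u w f g : R * R -> R) (s : R) :
  smooth_real u -> bounded_support u -> smooth_real w -> bounded_support w ->
  continuous f -> bounded_support f -> continuous g -> bounded_support g ->
  (forall z, f z = g z + ('D_ex u z + s * 'D_ey w z)) ->
  \int[@area R]_z f z = \int[@area R]_z g z.
Proof.
move=> su bu sw bw cf bf cg bg fg.
have iu := continuous_bounded_support_integrable
  (smooth_real_continuous (smooth_real_ex su)) (derive_ex_bounded_support bu).
have iw := continuous_bounded_support_integrable
  (smooth_real_continuous (smooth_real_ey sw)) (derive_ey_bounded_support bw).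
have ig := continuous_bounded_support_integrable cg bg.
have isw : (@area R).-integrable setT (EFin \o (fun z => s * 'D_ey w z)).
  exact: (integrableZl measurableT s iw).
have iuw : (@area R).-integrable setT
    (EFin \o (fun z => 'D_ex u z + s * 'D_ey w z)).
  exact: (integrableD measurableT iu isw).
under eq_Rintegral do rewrite fg.
rewrite RintegralD// RintegralD// RintegralZl// Rintegral_derive_ex//.
by rewrite Rintegral_derive_ey// mulr0 !addr0.
Qed.

Let E : R * R -> R := @coweight R.

(** Pointwise form of the integration by parts: a + ib and p + iq are the two test functions, the
    suffixes 1 and 2 mark their partial derivatives, and e is the weight, whose derivatives 2xe and
    2ye produce the multiplication term of [tadj]. *)
Let leibniz_rearrange (s x y e a b p q a1 a2 b1 b2 p1 p2 q1 q2 : R) :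
  ((2^-1 * a1 - s / 2 * b2) * p + (2^-1 * b1 + s / 2 * a2) * q) * e =
  (a * - ((2^-1 * p1 - - s / 2 * q2) + (x * p - - s * y * q)) +
   b * - ((2^-1 * q1 + - s / 2 * p2) + (x * q + - s * y * p))) * e +
  (2^-1 * ((a * p + b * q) * (2 * x * e) + e * (a * p1 + p * a1 + (b * q1 + q * b1)))
   + s * (2^-1 * ((a * q - b * p) * (2 * y * e) +
       e * (a * q2 + q * a2 - (b * p2 + p * b2))))).
Proof. by field. Qed.

Let lhs_smooth (s : R) a1 a2 b1 b2 p q :
  smooth_real a1 -> smooth_real a2 -> smooth_real b1 -> smooth_real b2 ->
  smooth_real p -> smooth_real q ->
  smooth_real (fun z => ((2^-1 * a1 z - s / 2 * b2 z) * p z +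
    (2^-1 * b1 z + s / 2 * a2 z) * q z) * E z).
Proof.
move=> sa1 sa2 sb1 sb2 sp sq; have sc := @smooth_real_cst R.
have sE : smooth_real E by exact: smooth_real_coweight.
apply: smooth_realM => //; apply: smooth_realD; apply: smooth_realM => //.
  by apply: smooth_realB; exact: smooth_realM.
by apply: smooth_realD; exact: smooth_realM.
Qed.

Let rhs_smooth (s : R) a b p q p1 p2 q1 q2 :
  smooth_real a -> smooth_real b -> smooth_real p -> smooth_real q ->
  smooth_real p1 -> smooth_real p2 -> smooth_real q1 -> smooth_real q2 ->
  smooth_real (fun z => (a z * - ((2^-1 * p1 z - - s / 2 * q2 z) +
       (z.1 * p z - - s * z.2 * q z)) +
     b z * - ((2^-1 * q1 z + - s / 2 * p2 z) +
       (z.1 * q z + - s * z.2 * p z))) * E z).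
Proof.
move=> sa sb sp sq sp1 sp2 sq1 sq2; have sc := @smooth_real_cst R.
have sE : smooth_real E by exact: smooth_real_coweight.
have sx := @smooth_real_fst R.
have sy : smooth_real (fun z => - s * z.2).
  by apply: smooth_realM; [exact: sc | exact: smooth_real_snd].
apply: smooth_realM => //; apply: smooth_realD; apply: smooth_realM => //;
  apply: smooth_realN; apply: smooth_realD.
- by apply: smooth_realB; exact: smooth_realM.
- by apply: smooth_realB; exact: smooth_realM.
- by apply: smooth_realD; exact: smooth_realM.
- by apply: smooth_realD; exact: smooth_realM.
Qed.

Lemma adjoint_integral (s : R) a b p q :
  smooth_real a -> smooth_real b -> smooth_real p -> smooth_real q ->
  bounded_support a -> bounded_support b ->
  \int[@area R]_z (((2^-1 * 'D_ex a z - s / 2 * 'D_ey b z) * p z +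
    (2^-1 * 'D_ex b z + s / 2 * 'D_ey a z) * q z) * E z) =
  \int[@area R]_z ((a z * - ((2^-1 * 'D_ex p z - - s / 2 * 'D_ey q z) +
       (z.1 * p z - - s * z.2 * q z)) +
     b z * - ((2^-1 * 'D_ex q z + - s / 2 * 'D_ey p z) +
       (z.1 * q z + - s * z.2 * p z))) * E z).
Proof.
move=> sa sb sp sq ba bb.
have sE : smooth_real E by exact: smooth_real_coweight.
have sc := @smooth_real_cst R; have sx := @smooth_real_fst R.
have sy := @smooth_real_snd R.
have D := @smooth_realD R; have M := @smooth_realM R; have B := @smooth_realB R.
have dx := @smooth_real_ex R; have dy := @smooth_real_ey R.
have ax := derive_ex_bounded_support ba; have ay := derive_ey_bounded_support ba.
have bx := derive_ex_bounded_support bb; have by_ := derive_ey_bounded_support bb.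
have bM f g : bounded_support f -> bounded_support (fun z => f z * g z).
  by apply: bounded_supportS => z; rewrite mulf_eq0 negb_or => /andP[].
have bMr f g : bounded_support g -> bounded_support (fun z => f z * g z).
  by apply: bounded_supportS => z; rewrite mulf_eq0 negb_or => /andP[].
have bN f : bounded_support f -> bounded_support (fun z => - f z).
  by apply: bounded_supportS => z; rewrite oppr_eq0.
have bD f g : bounded_support f -> bounded_support g ->
    bounded_support (fun z => f z + g z).
  move=> [A fA] [B' gB]; exists (Num.max A B') => z fg; rewrite !le_max.
  have [fz|/fA[-> ->]//] := eqVneq (f z) 0.
  by have [|-> ->] := gB z; rewrite ?orbT//; move: fg; rewrite fz add0r.
(* With phi = a + ib and psi = p + iq, the two fields are half the real and half the imaginary part
   of conj(phi) psi, times the weight. *)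
apply: (@Rintegral_derive_pair
    (fun z => 2^-1 * ((a z * p z + b z * q z) * E z))
    (fun z => 2^-1 * ((a z * q z - b z * p z) * E z)) _ _ s).
- by apply: (M) => //; apply: (M) => //; apply: (D); apply: (M).
- by apply: (bMr); apply: (bM); apply: (bD); exact: (bM).
- by apply: (M) => //; apply: (M) => //; apply: (B); apply: (M).
- by apply: (bMr); apply: (bM); apply: (bD); [exact: (bM) | apply: (bN); apply: (bM)].
- exact: (smooth_real_continuous (lhs_smooth s (dx _ sa) (dy _ sa) (dx _ sb) (dy _ sb) sp sq)).
- apply: (bM); apply: (bD); apply: (bM); apply: (bD); try exact: (bMr).
  by apply: (bN); exact: (bMr).
- exact: (smooth_real_continuous (rhs_smooth s sa sb sp sq (dx _ sp) (dy _ sp) (dx _ sq) (dy _ sq))).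
- by apply: (bM); apply: (bD); exact: (bM).
move=> z.
have dxM (f g : R * R -> R) w : smooth_real f -> smooth_real g ->
    'D_ex (fun z => f z * g z) w = f w * 'D_ex g w + g w * 'D_ex f w.
  by move=> sf sg; rewrite deriveM//; exact: smooth_real_derivable_ex.
have dyM (f g : R * R -> R) w : smooth_real f -> smooth_real g ->
    'D_ey (fun z => f z * g z) w = f w * 'D_ey g w + g w * 'D_ey f w.
  by move=> sf sg; rewrite deriveM//; exact: smooth_real_derivable_ey.
rewrite (dxM (fun=> 2^-1))//; last by apply: (M) => //; apply: (D); exact: (M).
rewrite (dyM (fun=> 2^-1))//; last by apply: (M) => //; apply: (B); exact: (M).
rewrite !derive_cst !mulr0 !addr0.
rewrite (dxM (fun z => a z * p z + b z * q z))//; last by apply: (D); exact: (M).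
rewrite (dyM (fun z => a z * q z - b z * p z))//; last by apply: (B); exact: (M).
rewrite derive_ex_coweight derive_ey_coweight.
rewrite deriveD; try by apply: smooth_real_derivable_ex; exact: (M).
rewrite deriveB; try by apply: smooth_real_derivable_ey; exact: (M).
(* After the product rules the goal is an instance of [leibniz_rearrange]. *)
by rewrite !dxM// !dyM//.
Qed.

End AdjointIntegral.

Section TestForm.
Context {R : realType}.
Implicit Types (phi psi : testfun R) (z : R * R).

Lemma testfun_smooth_Re phi : smooth_real (fun z => Re (phi z)).
Proof. exact: ((smoothP phi).1 (testfun_smooth phi)).1. Qed.

Lemma testfun_smooth_Im phi : smooth_real (fun z => Im (phi z)).
Proof. exact: ((smoothP phi).1 (testfun_smooth phi)).2. Qed.

Lemma testfun_bounded_support phi (h : R * R -> R) :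
  (forall z, phi z = 0 -> h z = 0) -> bounded_support h.
Proof.
move=> ph; apply: (compact_bounded_support (testfunP phi).2) => z hz.
apply: (@subset_closure _ [set w | phi w != 0]) => /=.
by apply: contra_neq hz; exact: ph.
Qed.

(** Real part of the inner product of L^2(exp(|z|^2)). *)
Definition tform phi psi : R :=
  \int[@area R]_z
    ((Re (phi z) * Re (psi z) + Im (phi z) * Im (psi z)) * coweight z).

Lemma tform_integrable phi psi : (@area R).-integrable setT (EFin \o
  (fun z => (Re (phi z) * Re (psi z) + Im (phi z) * Im (psi z)) * coweight z)).
Proof.
apply: continuous_bounded_support_integrable.
  apply: smooth_real_continuous; apply: smooth_realM; last exact: smooth_real_coweight.
  by apply: smooth_realD; apply: smooth_realM;
    (exact: testfun_smooth_Re || exact: testfun_smooth_Im).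
by apply: (@testfun_bounded_support phi) => z ->; rewrite !mul0r addr0 mul0r.
Qed.

Lemma tform_re_hermitian : re_hermitian tform.
Proof.
split.
- move=> phi psi; apply: eq_Rintegral => z _.
  by rewrite mulrC (mulrC (Im _)) (mulrC (Re _)) mulrC.
- move=> phi psi chi; rewrite -RintegralD//; try exact: tform_integrable.
  apply: eq_Rintegral => z _; rewrite -mulrDl; congr (_ * _).
  rewrite -[(phi + psi) z]/(phi z + psi z).
  by case: (phi z) (psi z) => [? ?] [? ?] /=; ring.
- move=> t phi psi; rewrite -RintegralZl//; last exact: tform_integrable.
  apply: eq_Rintegral => z _; rewrite mulrA; congr (_ * _).
  rewrite -[(t%:C *: phi) z]/(t%:C * phi z).
  by case: (phi z) => [? ?] /=; ring.
- move=> a phi psi; apply: eq_Rintegral => z _; congr (_ * _).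
  rewrite -[(a *: phi) z]/(a * phi z) -[(a^*%C *: psi) z]/(a^*%C * psi z).
  by case: a (phi z) (psi z) => [? ?] [? ?] [? ?] /=; ring.
- move=> phi; apply: Rintegral_ge0 => z _.
  by rewrite mulr_ge0 ?(ltW (coweight_gt0 _))// addr_ge0// -expr2 sqr_ge0.
Qed.

Lemma Re_tdir s phi z : Re (tdir s phi z) =
  2^-1 * 'D_ex (fun w => Re (phi w)) z - s / 2 * 'D_ey (fun w => Im (phi w)) z.
Proof.
rewrite tdirE (_ : 2^-1 = (2^-1)%:C); last by rewrite fmorphV rmorph_nat.
by rewrite -[tderive_ex _ _]/(pderive _ _ _) -[tderive_ey _ _]/(pderive _ _ _)
  /pderive /= !mul0r subr0 sub0r.
Qed.

Lemma Im_tdir s phi z : Im (tdir s phi z) =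
  2^-1 * 'D_ex (fun w => Im (phi w)) z + s / 2 * 'D_ey (fun w => Re (phi w)) z.
Proof.
rewrite tdirE (_ : 2^-1 = (2^-1)%:C); last by rewrite fmorphV rmorph_nat.
by rewrite -[tderive_ex _ _]/(pderive _ _ _) -[tderive_ey _ _]/(pderive _ _ _)
  /pderive /= !mul0r addr0 add0r.
Qed.

Lemma tform_adjoint s phi psi :
  tform (tdir s phi) psi = tform phi (tadj s psi).
Proof.
have [a1 b1] := (testfun_smooth_Re phi, testfun_smooth_Im phi).
have [p1 q1] := (testfun_smooth_Re psi, testfun_smooth_Im psi).
have ba : bounded_support (fun z => Re (phi z)).
  by apply: (@testfun_bounded_support phi) => z ->.
have bb : bounded_support (fun z => Im (phi z)).
  by apply: (@testfun_bounded_support phi) => z ->.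
apply: etrans (etrans (adjoint_integral s a1 b1 p1 q1 ba bb) _).
  by apply: eq_Rintegral => z _; rewrite Re_tdir Im_tdir.
apply: eq_Rintegral => z _.
have tadjE : tadj s psi z = - (tdir (- s) psi z + coordz (- s) z * psi z) by [].
rewrite tadjE -Re_tdir -Im_tdir /coordz.
by case: (tdir _ _ _) (psi z) => [? ?] [? ?].
Qed.

Lemma tdir_d_z phi : testfun_val (tdir (-1) phi) = d_z phi.
Proof.
apply/funext => z; rewrite -[LHS]/(tdir (-1) phi z) tdirE /d_z mulrDr.
congr (_ + _); rewrite -mulNr mulrA; congr (_ * _).
rewrite (_ : 2^-1 = (2^-1)%:C); last by rewrite fmorphV rmorph_nat.
by apply: complex_ext; rewrite /= ?oppr0; ring.
Qed.

Lemma tdir_d_zbar phi : testfun_val (tdir 1 phi) = d_zbar phi.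
Proof.
apply/funext => z; rewrite -[LHS]/(tdir 1 phi z) tdirE /d_zbar mulrDr.
congr (_ + _); rewrite mulrA; congr (_ * _).
rewrite (_ : 2^-1 = (2^-1)%:C); last by rewrite fmorphV rmorph_nat.
by apply: complex_ext; rewrite /=; ring.
Qed.

Definition toperator (k : nat) (alpha : R) (c : R[i]) phi : testfun R :=
  alpha%:C *: iter k (tdir (-1)) (iter k (tdir 1) phi) + c *: phi.

Lemma toperatorE k alpha c phi z : toperator k alpha c phi z =
  alpha%:C * iter k d_z (iter k d_zbar phi) z + c * phi z.
Proof.
have Ez j psi : testfun_val (iter j (tdir (-1)) psi) = iter j d_z psi.
  by elim: j => // j IH; rewrite !iterS -IH; exact: tdir_d_z.
have Ezbar j psi : testfun_val (iter j (tdir 1) psi) = iter j d_zbar psi.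
  by elim: j => // j IH; rewrite !iterS -IH; exact: tdir_d_zbar.
by rewrite -Ezbar -Ez.
Qed.

Lemma toperator_linear k alpha c : linear (toperator k alpha c).
Proof.
move=> a phi psi; have itlin s j x y :
    iter j (tdir s) (a *: x + y) = a *: iter j (tdir s) x + iter j (tdir s) y.
  by elim: j => //= j ->; rewrite (linearP (tdir s)).
rewrite /toperator !itlin !scalerDr !scalerA !(mulrC a).
by rewrite addrACA.
Qed.

Lemma toperator_coercive k alpha c phi : (0 < k)%N -> 1 <= `|alpha| ->
  rh_norm tform phi <= k`!%:R^-1 * rh_norm tform (toperator k alpha c phi).
Proof.
move=> k0 a1.
have sgn : (-1 : R) ^+ 2 = 1 by rewrite sqrrN expr1n.
have comm1 := expr1n R 2.
have C1 (x : testfun R) : tadj (-1) (tdir (-1) x) = tdir (-1) (tadj (-1) x) + x.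
  exact: (tadj_tdir x sgn).
have C2 (x : testfun R) : tadj 1 (tdir 1 x) = tdir 1 (tadj 1 x) + x by exact: (tadj_tdir x comm1).
have C4 (x : testfun R) : tadj (-1) (tdir 1 x) = tdir 1 (tadj (-1) x).
  by have := tadj_tdirN x sgn; rewrite opprK.
have := ladder_pair_bound tform_re_hermitian (tform_adjoint (-1))
  (tform_adjoint 1) C1 C2 C4 c phi k0 a1.
rewrite -/(toperator k alpha c phi) => bound.
have k1 : 0 < k`!%:R :> R by rewrite ltr0n fact_gt0.
rewrite mulrC ler_pdivlMr// mulrC.
rewrite -(ler_pXn2r (ltn0Sn 1)) ?nnegrE ?mulr_ge0 ?rh_norm_ge0//.
by rewrite exprMn !(rh_norm2 tform_re_hermitian).
Qed.

End TestForm.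

(** * The weighted L2 space *)

Section L2Form.
Context {R : realType}.
Implicit Types (f g : L2fun R) (z : R * R) (v : R * R -> R[i]).

Lemma normc_sqr (x : R[i]) : normc x ^+ 2 = Re x ^+ 2 + Im x ^+ 2.
Proof. by case: x => a b /=; rewrite sqr_sqrtr// addr_ge0// sqr_ge0. Qed.

Lemma L2funP f : inL2 f.
Proof. by case: f => v /=; rewrite inE. Qed.

(** Multiplication by this square root of the weight maps the weighted space isometrically into the
    unweighted L^2, where [fast_cauchy_L2_limit] applies. *)
Definition half_weight z : R := expR (- 2^-1 * (z.1 ^+ 2 + z.2 ^+ 2)).

Lemma half_weight_sqr z : half_weight z ^+ 2 = weight z.
Proof. by rewrite -expRM_natl mulrA mulrN divff ?pnatr_eq0// mulN1r. Qed.

Lemma half_weight_gt0 z : 0 < half_weight z. Proof. exact: expR_gt0. Qed.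

Let measurable_expR_sqr (c : R) :
  measurable_fun [set: plane R] (fun z => expR (c * (z.1 ^+ 2 + z.2 ^+ 2))).
Proof.
apply: measurableT_comp => //; apply: measurable_funM => //.
by apply: measurable_funD; apply: measurable_funX.
Qed.

Lemma measurable_half_weight : measurable_fun [set: plane R] half_weight.
Proof. exact: measurable_expR_sqr. Qed.

Lemma measurable_half_weightV :
  measurable_fun [set: plane R] (fun z => (half_weight z)^-1).
Proof.
under eq_fun do rewrite -expRN -mulNr opprK; exact: measurable_expR_sqr.
Qed.

Lemma measurable_weight : measurable_fun [set: plane R] (@weight R).
Proof.
rewrite (_ : @weight R = fun z => half_weight z ^+ 2).
  by apply: measurable_funX; exact: measurable_half_weight.
by apply/funext => z; rewrite half_weight_sqr.
Qed.

Lemma weight_gt0 z : 0 < weight z. Proof. exact: expR_gt0. Qed.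

Lemma measurable_cfun_normc_sqr v : measurable_cfun v ->
  measurable_fun [set: plane R] (fun z => normc (v z) ^+ 2).
Proof.
move=> [mr mi]; under eq_fun do rewrite normc_sqr.
by apply: measurable_funD; apply: measurable_funX.
Qed.

Lemma measurable_sqnorm v : measurable_cfun v ->
  measurable_fun [set: plane R] (fun z => (normc (v z) ^+ 2 * weight z)%:E).
Proof.
move=> mv; apply/measurable_EFinP; apply: measurable_funM.
  exact: measurable_cfun_normc_sqr.
exact: measurable_weight.
Qed.

(* The weight is bounded below on compact sets, so local square integrability
   is automatic. *)
Lemma inL2_sqnorm v : measurable_cfun v -> (sqnorm v < +oo)%E -> inL2 v.
Proof.
move=> mv nv; split => //; split => // K cK.
have mK : measurable (K : set (plane R)).
  rewrite -[K]setCK; apply: measurableC; apply: open_plane_measurable.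
  by rewrite openC; apply: compact_closed => //; exact: norm_hausdorff.
have [M [_ KM]] := compact_bounded cK.
pose r := `|M| + 1; pose C := expR (r ^+ 2 + r ^+ 2).
have C0 : 0 <= C by exact: expR_ge0.
have Kr z : K z -> 1 <= C * weight z.
  move=> Kz; have /KM/(_ z Kz) : M < r by have := ler_norm M; rewrite /r; lra.
  rewrite /= prod_normE/= ge_max => /andP[z1 z2].
  rewrite -expRD -expR0 ler_expR.
  have r0 : 0 <= r by rewrite addr_ge0.
  have s1 : z.1 ^+ 2 <= r ^+ 2 by rewrite -[z.1 ^+ 2]real_normK ?num_real// lerXn2r.
  have s2 : z.2 ^+ 2 <= r ^+ 2 by rewrite -[z.2 ^+ 2]real_normK ?num_real// lerXn2r.
  lra.
have F0 z : (0 <= (normc (v z) ^+ 2 * weight z)%:E)%E.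
  by rewrite lee_fin mulr_ge0 ?sqr_ge0// ltW// weight_gt0.
apply: (@le_lt_trans _ _ (C%:E * sqnorm v)%E); last by rewrite lte_mul_pinfty.
apply: (@le_trans _ _ (\int[area]_(z in K) (C%:E * (normc (v z) ^+ 2 * weight z)%:E))%E).
  apply: ge0_le_integral => //.
  - by move=> z _; rewrite lee_fin sqr_ge0.
  - apply/measurable_EFinP; apply: (measurable_funS measurableT) => //.
    exact: measurable_cfun_normc_sqr.
  - apply: (measurable_funS measurableT) => //; apply: measurable_funeM.
    exact: measurable_sqnorm.
  - move=> z Kz; rewrite -EFinM lee_fin mulrCA ler_peMr ?sqr_ge0//.
    exact: Kr.
rewrite ge0_integralZl//; last first.
  by apply: (measurable_funS measurableT) => //; exact: measurable_sqnorm.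
rewrite lee_wpmul2l//; apply: ge0_subset_integral => //.
exact: measurable_sqnorm.
Qed.

Definition lform f g : R :=
  \int[@area R]_z ((Re (f z) * Re (g z) + Im (f z) * Im (g z)) * weight z).

Lemma L2fun_measurable f : measurable_cfun f. Proof. exact: (L2funP f).1.1. Qed.

Lemma L2fun_sqnorm_integrable f : (@area R).-integrable setT
  (EFin \o (fun z => normc (f z) ^+ 2 * weight z)).
Proof.
apply/integrableP; split; first by apply: measurable_sqnorm; exact: L2fun_measurable.
apply: le_lt_trans (L2funP f).2; rewrite le_eqVlt; apply/orP; left; apply/eqP.
apply: eq_integral => z _.
by rewrite /= ger0_norm// mulr_ge0 ?sqr_ge0// ltW// weight_gt0.
Qed.

Lemma lform_measurable f g : measurable_fun [set: plane R] (fun z =>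
  (Re (f z) * Re (g z) + Im (f z) * Im (g z)) * weight z).
Proof.
have [[fr fi] [gr gi]] := (L2fun_measurable f, L2fun_measurable g).
apply: measurable_funM; last exact: measurable_weight.
by apply: measurable_funD; exact: measurable_funM.
Qed.

Lemma lform_integrable f g : (@area R).-integrable setT (EFin \o (fun z =>
  (Re (f z) * Re (g z) + Im (f z) * Im (g z)) * weight z)).
Proof.
have := integrableD measurableT (L2fun_sqnorm_integrable f) (L2fun_sqnorm_integrable g).
apply: le_integrable => //; first by apply/measurable_EFinP; exact: lform_measurable.
move=> z _; rewrite /= lee_fin -mulrDl !normrM.
rewrite ler_wpM2r// !normc_sqr ler_norml ger0_norm ?addr_ge0 ?sqr_ge0//.
have := sqr_ge0 (Re (f z) - Re (g z)); have := sqr_ge0 (Im (f z) - Im (g z)).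
have := sqr_ge0 (Re (f z) + Re (g z)); have := sqr_ge0 (Im (f z) + Im (g z)).
move: (Re (f z)) (Re (g z)) (Im (f z)) (Im (g z)) => a b c d; nra.
Qed.

Lemma lform_sqnorm f : (lform f f)%:E = sqnorm f.
Proof.
rewrite /lform /Rintegral fineK; last exact/integrable_fin_num/lform_integrable.
by apply: eq_integral => z _; rewrite normc_sqr -!expr2.
Qed.

Lemma lform_re_hermitian : re_hermitian lform.
Proof.
split.
- move=> f g; apply: eq_Rintegral => z _.
  by rewrite mulrC (mulrC (Im _)) (mulrC (Re _)) mulrC.
- move=> f g h; rewrite -RintegralD//; try exact: lform_integrable.
  apply: eq_Rintegral => z _; rewrite -mulrDl; congr (_ * _).
  rewrite -[(f + g) z]/(f z + g z).
  by case: (f z) (g z) => [? ?] [? ?] /=; ring.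
- move=> t f g; rewrite -RintegralZl//; last exact: lform_integrable.
  apply: eq_Rintegral => z _; rewrite mulrA; congr (_ * _).
  rewrite -[(t%:C *: f) z]/(t%:C * f z).
  by case: (f z) => [? ?] /=; ring.
- move=> a f g; apply: eq_Rintegral => z _; congr (_ * _).
  rewrite -[(a *: f) z]/(a * f z) -[(a^*%C *: g) z]/(a^*%C * g z).
  by case: a (f z) (g z) => [? ?] [? ?] [? ?] /=; ring.
- move=> f; apply: Rintegral_ge0 => z _.
  by rewrite mulr_ge0 ?(ltW (weight_gt0 _))// addr_ge0// -expr2 sqr_ge0.
Qed.

Lemma sqnorm_split v : measurable_cfun v -> sqnorm v =
  (\int[area]_z ((Re (v z) * half_weight z) ^+ 2)%:E +
   \int[area]_z ((Im (v z) * half_weight z) ^+ 2)%:E)%E.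
Proof.
move=> [mr mi]; have mw := measurable_half_weight.
rewrite -ge0_integralD//.
- apply: eq_integral => z _.
  by rewrite -EFinD !exprMn -mulrDl normc_sqr half_weight_sqr.
- by move=> z _; rewrite lee_fin sqr_ge0.
- by apply/measurable_EFinP; apply: measurable_funX; exact: measurable_funM.
- by move=> z _; rewrite lee_fin sqr_ge0.
- by apply/measurable_EFinP; apply: measurable_funX; exact: measurable_funM.
Qed.

Lemma lform_complete (w : nat -> L2fun R) :
  (forall n, lform (w n.+1 - w n) (w n.+1 - w n) <= 4^-1 ^+ n) ->
  exists u, (fun n => lform (u - w n) (u - w n)) @ \oo --> 0.
Proof.
move=> w_fast; have mw := measurable_half_weight.
have split_fast n := sqnorm_split (L2fun_measurable (w n.+1 - w n)).
have int_ge0 (h : R * R -> R) : (0 <= \int[@area R]_z (h z ^+ 2)%:E)%E.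
  by apply: integral_ge0 => z _; rewrite lee_fin sqr_ge0.
have [h1 mh1 h1P] : exists2 h : R * R -> R, measurable_fun [set: plane R] h & forall n,
    (\int[@area R]_z ((h z - Re (w n z) * half_weight z) ^+ 2)%:E <=
      (4 * 2^-1 ^+ n)%:E)%E.
  apply: (@fast_cauchy_L2_limit _ (plane R) R (@area R)
    (fun n z => Re (w n z) * half_weight z)) => n.
    by apply: measurable_funM => //; exact: (L2fun_measurable (w n)).1.
  apply: (@le_trans _ _ (lform (w n.+1 - w n) (w n.+1 - w n))%:E); last first.
    by rewrite lee_fin; exact: w_fast.
  rewrite lform_sqnorm split_fast; apply: le_trans (leeDl _ (int_ge0 _)).
  rewrite le_eqVlt; apply/orP; left; apply/eqP.
  apply: eq_integral => z _; rewrite -mulrBl.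
  rewrite -[(w n.+1 - w n) z]/(w n.+1 z - w n z).
  by case: (w n.+1 z) (w n z) => [? ?] [? ?].
have [h2 mh2 h2P] : exists2 h : R * R -> R, measurable_fun [set: plane R] h & forall n,
    (\int[@area R]_z ((h z - Im (w n z) * half_weight z) ^+ 2)%:E <=
      (4 * 2^-1 ^+ n)%:E)%E.
  apply: (@fast_cauchy_L2_limit _ (plane R) R (@area R)
    (fun n z => Im (w n z) * half_weight z)) => n.
    by apply: measurable_funM => //; exact: (L2fun_measurable (w n)).2.
  apply: (@le_trans _ _ (lform (w n.+1 - w n) (w n.+1 - w n))%:E); last first.
    by rewrite lee_fin; exact: w_fast.
  rewrite lform_sqnorm split_fast; apply: le_trans (leeDr _ (int_ge0 _)).
  rewrite le_eqVlt; apply/orP; left; apply/eqP.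
  apply: eq_integral => z _; rewrite -mulrBl.
  rewrite -[(w n.+1 - w n) z]/(w n.+1 z - w n z).
  by case: (w n.+1 z) (w n z) => [? ?] [? ?].
(* The real and imaginary limits were found after multiplication by [half_weight], which never
   vanishes and is now divided out. *)
pose v z : R[i] := (h1 z / half_weight z) +i* (h2 z / half_weight z).
have mvw n : measurable_cfun (fun z => v z - w n z).
  have mV := measurable_half_weightV; have [mr mi] := L2fun_measurable (w n).
  split.
    rewrite (_ : (fun _ => _) = (fun z => h1 z / half_weight z - Re (w n z))).
      by apply: measurable_funB => //; exact: measurable_funM.
    by apply/funext => z; case: (w n z).
  rewrite (_ : (fun _ => _) = (fun z => h2 z / half_weight z - Im (w n z))).
    by apply: measurable_funB => //; exact: measurable_funM.
  by apply/funext => z; case: (w n z).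
have nvw n : (sqnorm (fun z => (v z - w n z)%R) <= (8 * 2^-1 ^+ n)%:E)%E.
  rewrite sqnorm_split// (_ : 8 = 4 + 4); last by rewrite -natrD.
  rewrite mulrDl EFinD; apply: leeD.
    apply: le_trans (h1P n); rewrite le_eqVlt; apply/orP; left; apply/eqP.
    apply: eq_integral => z _; congr (_ ^+ 2)%:E.
    rewrite (_ : Re _ = h1 z / half_weight z - Re (w n z)); last by case: (w n z).
    by rewrite mulrBl divfK// gt_eqF// half_weight_gt0.
  apply: le_trans (h2P n); rewrite le_eqVlt; apply/orP; left; apply/eqP.
  apply: eq_integral => z _; congr (_ ^+ 2)%:E.
  rewrite (_ : Im _ = h2 z / half_weight z - Im (w n z)); last by case: (w n z).
  by rewrite mulrBl divfK// gt_eqF// half_weight_gt0.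
have vL2 : v \in @L2pred R.
  (* Only differences v - w n have been estimated, so membership of v is obtained from that of w
     0. *)
  have -> : v = (v - L2fun_val (w 0%N)) + L2fun_val (w 0%N) by rewrite subrK.
  rewrite rpredD//; last exact: valP.
  rewrite inE; apply: inL2_sqnorm; first exact: mvw.
  by apply: le_lt_trans (nvw 0%N) _; rewrite ltry.
exists (MkL2fun vL2).
apply: (@squeeze_cvgr _ _ _ _ (cst 0) (geometric 8 (2^-1))).
- apply: nearW => n; rewrite (rh_ge0 lform_re_hermitian)/= -lee_fin lform_sqnorm.
  exact: nvw.
- exact: cvg_cst.
- by apply: cvg_geometric; rewrite ger0_norm// invf_lt1//; lra.
Qed.

End L2Form.

(** * The solution operator *)

Section Duality.
Context {R : realType}.
Implicit Types (f g : L2fun R) (phi psi : testfun R) (z : R * R).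

(* With this embedding the bilinear pairing of u with psi is the inner product
   of u with [dual_test psi] in the weighted space. *)
Definition dual_val phi z : R[i] :=
  (Re (phi z) * coweight z) +i* (- Im (phi z) * coweight z).

(** The square of exp(|z|^2) against exp(-|z|^2) leaves exp(|z|^2), so the dual embedding carries
    the coercive estimate over to the target space. *)
Lemma dual_val_sqnorm phi : sqnorm (dual_val phi) = (tform phi phi)%:E.
Proof.
rewrite /tform /Rintegral fineK; last exact/integrable_fin_num/tform_integrable.
apply: eq_integral => z _; congr EFin; rewrite normc_sqr /=.
transitivity ((Re (phi z) * Re (phi z) + Im (phi z) * Im (phi z)) * coweight z *
  (coweight z * weight z)); last by rewrite coweightK mulr1.
by ring.
Qed.

Lemma dual_val_L2 phi : dual_val phi \in @L2pred R.
Proof.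
rewrite inE; apply: inL2_sqnorm; last by rewrite dual_val_sqnorm ltry.
have sE := @smooth_real_coweight R.
have sR := smooth_realM (testfun_smooth_Re phi) sE.
have sI := smooth_realM (smooth_realN (testfun_smooth_Im phi)) sE.
split; [exact: (continuous_plane_measurable (smooth_real_continuous sR))
       |exact: (continuous_plane_measurable (smooth_real_continuous sI))].
Qed.

Definition dual_test phi : L2fun R := MkL2fun (dual_val_L2 phi).

Lemma dual_test_conj (a : R[i]) phi psi :
  dual_test (a *: phi + psi) = a^*%C *: dual_test phi + dual_test psi.
Proof.
apply: val_inj; apply/funext => z.
rewrite -[LHS]/(dual_val (a *: phi + psi) z).
rewrite -[RHS]/(a^*%C * dual_val phi z + dual_val psi z) /dual_val testfun_lin.
by case: a (phi z) (psi z) => [? ?] [? ?] [? ?]; apply: complex_ext => /=; ring.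
Qed.

Lemma dual_testZ (a : R[i]) phi : dual_test (a *: phi) = a^*%C *: dual_test phi.
Proof.
have d0 : dual_test 0 = 0.
  apply: val_inj; apply/funext => z.
  by rewrite -[LHS]/(dual_val 0 z) /dual_val /= oppr0 !mul0r.
by have := dual_test_conj a phi 0; rewrite d0 !addr0.
Qed.

Lemma lform_dual_test f phi :
  lform f (dual_test phi) = \int[@area R]_z Re (f z * phi z).
Proof.
apply: eq_Rintegral => z _; rewrite -[dual_test phi z]/(dual_val phi z).
transitivity ((Re (f z) * Re (phi z) - Im (f z) * Im (phi z)) *
  (coweight z * weight z)).
  by rewrite /=; ring.
by rewrite coweightK mulr1 complexE_mul.
Qed.

Lemma rh_norm_dual_test phi : rh_norm lform (dual_test phi) = rh_norm tform phi.
Proof.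
rewrite /rh_norm; congr (Num.sqrt _); apply: EFin_inj.
by rewrite lform_sqnorm; exact: dual_val_sqnorm.
Qed.

(** The imaginary part of a number w is the real part of -i w. *)
Lemma cintegral_lform f phi : cintegral (fun z => f z * phi z) =
  lform f (dual_test phi) +i* lform f (dual_test ((- 'i%C) *: phi)).
Proof.
rewrite !lform_dual_test; congr (_ +i* _); apply: eq_Rintegral => z _.
rewrite -[((- 'i%C) *: phi) z]/(- 'i%C * phi z).
by case: (f z) (phi z) => [? ?] [? ?] /=; ring.
Qed.

Lemma lform_ae (f f' g : L2fun R) : {ae @area R, forall z, f z = f' z} ->
  lform f g = lform f' g.
Proof.
move=> ff'; congr fine; apply: ae_eq_integral => //.
- by apply/measurable_EFinP; exact: lform_measurable.
- by apply/measurable_EFinP; exact: lform_measurable.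
- by apply: filterS ff' => z fz _; rewrite fz.
Qed.

Lemma lform_eq0 f : lform f f = 0 -> {ae @area R, forall z, f z = 0}.
Proof.
move=> f0; have /integrableP[mf _] := L2fun_sqnorm_integrable f.
have : (\int[@area R]_z `|(normc (f z) ^+ 2 * weight z)%:E| = 0)%E.
  rewrite -[RHS]/(0%:E) -f0 lform_sqnorm; apply: eq_integral => z _.
  by rewrite gee0_abs// lee_fin mulr_ge0 ?sqr_ge0// ltW// weight_gt0.
move=> /(ae_eq_integral_abs _ measurableT mf); apply: filterS => z /(_ I) /eqP.
rewrite /= eqe mulf_eq0 (gt_eqF (weight_gt0 z)) orbF sqrf_eq0 => /eqP.
exact: eq0_normc.
Qed.

End Duality.

(** * Passage between functions and their classes *)

Section L2Classes.
Context {R : realType}.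
Implicit Types (u v : L2fun R) (f g : L2 R).

(** The same representative as [L2repr], kept as an [L2fun] so that [lform] applies to it. *)
Definition L2rep f : L2fun R := repr f.

Lemma L2repE f : L2class (L2rep f) = f. Proof. exact: reprK. Qed.

Lemma L2rep_class u : {ae @area R, forall z, L2rep (L2class u) z = u z}.
Proof. by apply/L2class_eq; exact: L2repE. Qed.

Lemma L2class_lin (a : R[i]) u v :
  L2class (a *: u + v) = a *: L2class u + L2class v.
Proof.
transitivity (L2class (a *: u) + L2class v).
  by rewrite /L2class !piE.
congr (_ + _); apply/L2class_eq; have := L2rep_class u.
by apply: filterS => z uz; rewrite -[RHS]/(a * L2rep (L2class u) z) uz.
Qed.

Lemma L2rep_lin (a : R[i]) f g :
  {ae @area R, forall z, L2rep (a *: f + g) z = (a *: L2rep f + L2rep g) z}.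
Proof. by apply/L2class_eq; rewrite L2class_lin !L2repE. Qed.

Lemma L2norm_rep f : L2norm f = rh_norm lform (L2rep f).
Proof. by rewrite /L2norm -[L2repr f]/(L2fun_val (L2rep f)) -lform_sqnorm. Qed.

Lemma L2norm_class u : L2norm (L2class u) = rh_norm lform u.
Proof.
rewrite L2norm_rep; congr Num.sqrt; have uu := L2rep_class u.
by rewrite (lform_ae _ uu) (rhC lform_re_hermitian) (lform_ae _ uu).
Qed.

End L2Classes.

Section SolutionOperator.
Context {R : realType} (k : nat) (c : R[i]) (alpha : R).
Hypotheses (k_ge1 : (1 <= k)%N) (alpha_ge1 : 1 <= `|alpha|).

Let G phi : L2fun R := dual_test (toperator k alpha c phi).

Let G_conj (a : R[i]) phi psi : G (a *: phi + psi) = a^*%C *: G phi + G psi.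
Proof. by rewrite /G toperator_linear dual_test_conj. Qed.

Let dual_test_le phi : rh_norm lform (dual_test phi) <=
  k`!%:R^-1 * rh_norm lform (G phi).
Proof. by rewrite !rh_norm_dual_test; exact: toperator_coercive. Qed.

Let solution_exists (f : L2fun R) : exists u : L2fun R,
  [/\ forall phi, lform u (G phi) = lform f (dual_test phi),
      forall v, (forall phi, lform (G phi) v = 0) -> lform u v = 0 &
      rh_norm lform u <= k`!%:R^-1 * rh_norm lform f].
Proof.
apply: (riesz_solution lform_re_hermitian lform_complete dual_test_conj G_conj).
  by rewrite invr_ge0.
exact: dual_test_le.
Qed.

Let sol f := projT1 (cid (solution_exists f)).
Let solP f := projT2 (cid (solution_exists f)).

Let GZ (a : R[i]) phi : a^*%C *: G phi = G (a *: phi).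
Proof.
rewrite /G -dual_testZ; congr dual_test.
have := toperator_linear k alpha c a phi 0; rewrite addr0 => ->.
have -> : toperator k alpha c 0 = 0.
  by have := toperator_linear k alpha c (-1) 0 0; rewrite scaler0 addr0 scaleN1r addNr.
by rewrite addr0.
Qed.

Definition solution_map (f : L2 R) : L2 R := L2class (sol (L2rep f)).

Let lform_lin (a : R[i]) u v w :
  lform (a *: u + v) w = lform u (a^*%C *: w) + lform v w.
Proof.
by rewrite (rhDl lform_re_hermitian) (rh_conj lform_re_hermitian).
Qed.

(* A solution orthogonal to the annihilator of the range of the adjoint is
   unique, hence depends linearly on the data. *)
Let solution_map_linear : linear solution_map.
Proof.
move=> a f g; rewrite /solution_map -L2class_lin; apply/L2class_eq.
have hl := @lform_re_hermitian R.
have [F1 F2 _] := solP (L2rep (a *: f + g)); have [f1 f2 _] := solP (L2rep f).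
have [g1 g2 _] := solP (L2rep g).
rewrite -/(sol _) in F1 F2; rewrite -/(sol _) in f1 f2; rewrite -/(sol _) in g1 g2.
set F := sol (L2rep (a *: f + g)) in F1 F2 *.
set u := sol (L2rep f) in f1 f2 *; set v := sol (L2rep g) in g1 g2 *.
(* The defect annihilates the range of [G], and it is orthogonal to all that annihilates this range,
   hence to itself. *)
pose d : L2fun R := F - (a *: u + v).
have d1 phi : lform (G phi) d = 0.
  rewrite (rhC hl) (rhDl hl) (rhNl hl) lform_lin GZ F1 f1 g1.
  rewrite (lform_ae _ (L2rep_lin a f g)) lform_lin dual_testZ; apply: subrr.
have d2 w : (forall phi, lform (G phi) w = 0) -> lform d w = 0.
  move=> Gw; rewrite (rhDl hl) (rhNl hl) lform_lin F2// g2// f2 ?addr0 ?subr0//.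
  (* The annihilator is stable under complex scalars, although [lform] is only a real part, because
     the range of [G] is. *)
  by move=> phi; rewrite -(rh_conj hl) -[a]conjcK GZ.
have : lform d d = 0 by exact: d2.
move=> /lform_eq0; apply: filterS => z.
exact: (@subr0_eq _ (F z) ((a *: u + v) z)).
Qed.

HB.instance Definition _ :=
  GRing.isLinear.Build R[i] (L2 R) (L2 R) _ solution_map solution_map_linear.

Lemma solution_map_norm f : L2norm (solution_map f) <= k`!%:R^-1 * L2norm f.
Proof.
by rewrite L2norm_class L2norm_rep; have [_ _] := solP (L2rep f).
Qed.

Lemma solution_map_weak f :
  weak_solution k alpha c (L2repr (solution_map f)) (L2repr f).
Proof.
split; first exact: (L2funP (L2rep (solution_map f))).1.
move=> phi tphi.
have phiP : phi \in @test_pred R by rewrite inE.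
pose psi : testfun R := MkTestfun phiP.
have [sol1 _ _] := solP (L2rep f).
have pair (x : testfun R) :
    lform (L2rep (solution_map f)) (G x) = lform (L2rep f) (dual_test x).
  by rewrite (lform_ae _ (L2rep_class _)); exact: sol1.
transitivity (cintegral (fun z => L2rep (solution_map f) z *
    toperator k alpha c psi z)).
  by congr cintegral; apply/funext => z; rewrite toperatorE.
transitivity (cintegral (fun z => L2rep f z * psi z)) => //.
(* The imaginary parts agree by [pair] at -i psi, the operator being complex linear. *)
rewrite !cintegral_lform; congr (_ +i* _); first exact: pair.
by rewrite -pair -GZ dual_testZ.
Qed.

End SolutionOperator.

Theorem theorem4p7 (R : realType) (k : nat) (c : R[i]) (alpha : R)
    (k_ge1 : (1 <= k)%N) (alpha_ge1 : 1 <= `|alpha|) :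
  exists T : {linear L2 R -> L2 R},
    [/\ bounded_operator T,
        forall f : L2 R, weak_solution k alpha c (L2repr (T f)) (L2repr f)
      & opnorm T ^+ 2 <= 1 / (k`!)%:R ^+ 2].
Proof.
pose T : {linear L2 R -> L2 R} := solution_map c k_ge1 alpha_ge1.
have Tle f : L2norm (T f) <= k`!%:R^-1 * L2norm f by exact: solution_map_norm.
have k0 : 0 <= (k`!%:R : R)^-1 by rewrite invr_ge0.
exists T; split; first by exists k`!%:R^-1.
  by move=> f; exact: solution_map_weak.
have norm0 : L2norm (0 : L2 R) = 0.
  have -> : (0 : L2 R) = L2class 0 by rewrite /L2class !piE.
  by rewrite L2norm_class /rh_norm (rh0l lform_re_hermitian) sqrtr0.
have ub : ubound [set L2norm (T f) | f in [set f | L2norm f <= 1]] k`!%:R^-1.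
  by move=> _ [f /= f1 <-]; rewrite (le_trans (Tle f))// ler_piMr.
(* [sup] is meaningful only for a nonempty bounded set; this element also shows that [opnorm T] is
   nonnegative, as squaring the bound requires. *)
have ne : [set L2norm (T f) | f in [set f | L2norm f <= 1]] (L2norm (T 0)).
  by exists 0 => //=; rewrite norm0 ler01.
have op0 : 0 <= opnorm T.
  apply: le_trans (ub_le_sup _ ne); first exact: sqrtr_ge0.
  by exists k`!%:R^-1.
have op1 : opnorm T <= k`!%:R^-1 by apply: ge_sup => //; exists (L2norm (T 0)).
by rewrite div1r -exprVn lerXn2r// nnegrE.
Qed.
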